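(* In the setting described in the context, assume Conditions 1, 2, 3 and 6 listed there. Let $\mathfrak M$ be the model under consideration, with $|\mathfrak M|=d$ covariates and prior probability $\alpha_{\mathfrak M}>0$, and let $S(y,\mathfrak M;F_n)$ be its log-marginal-likelihood. Then, with probability tending to one, $$S(y,\mathfrak M;F_n)=\ell_n(y,\widehat\beta_n)-\frac{\log n}{2}|\mathfrak M|+\frac12\log|H_n|+\log\alpha_{\mathfrak M}+\frac{\log(2\pi)}{2}|\mathfrak M|+\log c_n+o(1),$$ where $H_n=A_n^{-1}B_n$, $|H_n|$ is its determinant, and $c_n\in[c_2,c_3]$.
   Context: Setting. For each $n$, $Y=(Y_1,\dots,Y_n)^T$ is a random vector (its observed value is denoted $y$, and $y$, $Y$ are used interchangeably) with independent (not necessarily identically distributed) components and unknown true density $g_n(y)=\prod_{i=1}^n g_{n,i}(y_i)$; the $EY_i^2$ are bounded uniformly in $i,n$. A model $\mathfrak M$ is a subset of $d=|\mathfrak M|$ of the available covariates; $X$ is the corresponding deterministic $n\times d$ design matrix, of full column rank $d$ (with $d=d_n$ allowed to grow), with rows $x_1^T,\dots,x_n^T$. The (possibly misspecified) working model $F_n(\cdot,\beta)$ is the generalized linear model with canonical link, with density proportional to $\exp[z^TX\beta-\mathbf 1^T\mathbf b(X\beta)]$ with respect to a fixed product measure, $\beta\in\mathbb{R}^d$, where $b:\mathbb{R}\to\mathbb{R}$ is a smooth convex function with $b''$ continuous and bounded away from $0$. For $\theta\in\mathbb{R}^n$, $\mathbf b(\theta)=(b(\theta_1),\dots,b(\theta_n))^T$,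 $\mu(\theta)=(b'(\theta_1),\dots,b'(\theta_n))^T$, $\Sigma(\theta)=\mathrm{diag}\{b''(\theta_1),\dots,b''(\theta_n)\}$. The quasi-log-likelihood (dropping a term not depending on $\beta$) is $\ell_n(y,\beta)=y^TX\beta-\mathbf 1^T\mathbf b(X\beta)$, and the quasi-maximum likelihood estimator is $\widehat\beta_n=\arg\max_{\beta\in\mathbb{R}^d}\ell_n(y,\beta)$. $\beta_{n,0}\in\mathbb{R}^d$ is the minimizer of the Kullback–Leibler divergence of the working model from the true model; it solves $X^T[EY-\mu(X\beta)]=0$. Put $B_n=X^T\mathrm{cov}(Y)X$, $A_n(\beta)=X^T\Sigma(X\beta)X$, $A_n=A_n(\beta_{n,0})$, $V_n(\beta)=B_n^{-1/2}A_n(\beta)B_n^{-1/2}$, $V_n=V_n(\beta_{n,0})$. $\|\cdot\|_2$ is the Euclidean norm of vectors and the operator norm of matrices. Log-marginal-likelihood. Let $h(\beta)=(n^{-1}B_n)^{1/2}\beta$. The prior $\mu_{\mathfrak M}$ is a probability distribution of $h(\beta)\in\mathbb{R}^d$ with density $\pi=d\mu_{\mathfrak M}/d\mu_0$ with respect to Lebesgue measure $\mu_0$ on $\mathbb{R}^d$, and $$S(y,\mathfrak M;F_n)=\log\int\alpha_{\mathfrak M}\exp[\ell_n(y,\beta)]\,d\mu_{\mathfrak M}=\log\Big(\alpha_{\mathfrak M}\int_{\mathbb{R}^d}\exp[\ell_n(y,h^{-1}(u))]\,\pi(u)\,du\Big).$$ Condition 1. There is a constant $H>0$ such that for each $1\le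 i\le n$, $P(|q_i|>t)\le H\exp(-t^2/H)$ for all $t\ge0$, where $(q_1,\dots,q_n)^T=\mathrm{cov}(Y)^{-1/2}(Y-EY)$. Condition 2. There are positive constants $c_1$, $c_0>8c_1^{-2}H$, and $r<1/4$ such that for all sufficiently large $n$, $\min_{\beta\in N_n(\delta_n)}\lambda_{\min}\{V_n(\beta)\}>c_1n^{-r}$, and $\lambda_{\min}(B_n)\gg d\delta_n^2$ (i.e. $d\delta_n^2/\lambda_{\min}(B_n)\to0$), where $\delta_n=n^r(c_0\log n)^{1/2}$ and, for $\delta>0$, $N_n(\delta)=\{\beta\in\mathbb{R}^d:\|(n^{-1}B_n)^{1/2}(\beta-\beta_{n,0})\|_2\le (n/d)^{-1/2}\delta\}$. Moreover $d=o\{n^{(1-4r)/3}(\log n)^{-2/3}\}$. Condition 3. $\sum_{i=1}^n(x_i^TB_n^{-1}x_i)^{3/2}=o(1)$ and $\max_{1\le i\le n}E|Y_i-EY_i|^3=O(1)$. Condition 6. The prior density satisfies $\inf_{\beta\in N_n(2\delta_n)}\pi(h(\beta))\ge c_2$ and $\sup_{\beta\in\mathbb{R}^d}\pi(h(\beta))\le c_3$ with some constants $c_2,c_3>0$, and $\rho_n(\delta_n)=\max_{\beta\in N_n(2\delta_n)}\max\{|\lambda_{\min}(V_n(\beta)-V_n)|,|\lambda_{\max}(V_n(\beta)-V_n)|\}=o\{n^{-(1-r)/3}\}$. *)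

(* Defs.v *)
From HB Require Import structures.
From mathcomp Require Import all_boot all_order all_algebra.
From mathcomp Require Import all_classical all_reals all_analysis.

Set Implicit Arguments.
Unset Strict Implicit.
Unset Printing Implicit Defensive.

Import Order.TTheory GRing.Theory Num.Theory.
Import numFieldNormedType.Exports.

Local Open Scope classical_set_scope.
Local Open Scope ring_scope.

Section lebesgue_tuple.
Context {R : realType}.

Local Notation RR := (measurableTypeR R).

Definition tcons n (p : RR * n.-tuple RR) : n.+1.-tuple RR := [tuple of p.1 :: p.2].

Lemma measurable_tcons n : measurable_fun setT (@tcons n).
Proof.
exact: (measurable_cons (@measurable_fst _ _ _ _) (@measurable_snd _ _ _ _)).
Qed.

Section step.
Context n (m : {sigma_finite_measure set (n.-tuple RR) -> \bar R}).

Definition leb_step : set (n.+1.-tuple RR) -> \bar R :=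
  pushforward (@lebesgue_measure R \x m)%E
    (@tcons n).

Let pushm : {measure set (n.+1.-tuple RR) -> \bar R} :=
  measure_function_pushforward__canonical__measure_function_Measure
    (@lebesgue_measure R \x m)%E (@measurable_tcons n).

Let leb_step0 : leb_step set0 = 0%E. Proof. exact: (measure0 pushm). Qed.
Let leb_step_ge0 A : (0 <= leb_step A)%E. Proof. exact: (measure_ge0 pushm). Qed.
Let leb_step_sigma_additive : semi_sigma_additive leb_step.
Proof. exact: (@measure_semi_sigma_additive _ _ _ pushm). Qed.

HB.instance Definition _ := isMeasure.Build _ _ _ leb_step
  leb_step0 leb_step_ge0 leb_step_sigma_additive.

Let leb_step_sigma_finite : sigma_finite setT leb_step.
Proof.
have /sigma_finiteP[F [TF ndF Foo]] := sigma_finiteT (@lebesgue_measure R).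
have /sigma_finiteP[G [TG ndG Goo]] := sigma_finiteT m.
pose u (t : n.+1.-tuple RR) : RR * n.-tuple RR := (thead t, [tuple of behead t]).
have mu : measurable_fun setT u.
  apply/measurable_fun_pair; last exact: measurable_behead.
  exact: (measurable_tnth ord0).
have uK : u \o @tcons n = id.
  by apply/funext => -[x t]; rewrite /u /tcons /= theadE; congr pair; apply/val_inj.
exists (fun k => u @^-1` (F k `*` G k)).
  apply/esym/seteqP; split=> // t _.
  have [i _ Fi] : (\bigcup_i F i) (u t).1 by rewrite -TF.
  have [j _ Gj] : (\bigcup_j G j) (u t).2 by rewrite -TG.
  exists (maxn i j) => //; split.
    by move: Fi; exact/subsetPset/ndF/leq_maxl.
  by move: Gj; exact/subsetPset/ndG/leq_maxr.
move=> k; have [mF Fk] := Foo k; have [mG Gk] := Goo k; split.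
  by rewrite -[X in measurable X]setTI; apply: mu => //; exact: measurableX.
rewrite /leb_step /pushforward -comp_preimage uK preimage_id product_measure1E//.
by rewrite lte_mul_pinfty// ge0_fin_numE.
Qed.

HB.instance Definition _ := Measure_isSigmaFinite.Build _ _ _ leb_step
  leb_step_sigma_finite.

End step.

(* Lebesgue measure on R^n as the n-fold product of the one on the line, R^n being
   the type of n-tuples with its product sigma-algebra; [cvec] passes to columns *)
Fixpoint lebesgue_tuple n : {sigma_finite_measure set (n.-tuple RR) -> \bar R} :=
  match n with
  | 0 => dirac [tuple]
  | n'.+1 => leb_step (lebesgue_tuple n')
  end.

Definition cvec n (t : n.-tuple RR) : 'cV[R]_n := \col_i tnth t i.

End lebesgue_tuple.

Section linear_algebra.
Context {R : realType}.

Definition norm2 n (v : 'cV[R]_n) : R := Num.sqrt (\sum_i v i 0 ^+ 2).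

Definition psdmx n (A : 'M[R]_n) :=
  A^T = A /\ forall v : 'cV[R]_n, 0 <= (v^T *m A *m v) 0 0.

(* A^{1/2}: the (unique) positive semidefinite square root; 0 if there is none *)
Definition sqrtmx n (A : 'M[R]_n) : 'M[R]_n :=
  xget 0 [set S | psdmx S /\ S *m S = A].

Definition isqrtmx n (A : 'M[R]_n) : 'M[R]_n := invmx (sqrtmx A).

Definition lambda_min n (A : 'M[R]_n) : R := inf [set a | eigenvalue A a].
Definition lambda_max n (A : 'M[R]_n) : R := sup [set a | eigenvalue A a].

End linear_algebra.

Definition mutually_independent {R : realType} {disp} {Omega : measurableType disp}
    (P : probability Omega R) n (Y : 'I_n -> Omega -> R) :=
  forall (J : {set 'I_n}) (A : 'I_n -> set R), (forall i, measurable (A i)) ->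
    P (\bigcap_(i in [set j | j \in J]) (Y i @^-1` A i)) =
    (\prod_(i in J) P (Y i @^-1` A i))%E.

(* The objects attached to one sample size n; the function b of the generalized
   linear model is common to all n and kept apart. *)
Record glm_data (R : realType) (n d : nat) := GlmData {
  disp : measure_display;
  Omega : measurableType disp;
  Pr : probability Omega R;
  Y : 'I_n -> {RV Pr >-> R};
  base : 'I_n -> {measure set R -> \bar R}; (* coordinates of the dominating product measure *)
  dens : 'I_n -> R -> R;                    (* true densities g_{n,i} *)
  X : 'M[R]_(n, d);
  beta0 : 'cV[R]_d;
  alpha : R;                                (* prior probability of the model *)
  prior : 'cV[R]_d -> R                     (* prior density of h(beta) *)
}.

Section glm.
Context {R : realType} (b : R -> R) {n d : nat} (D : glm_data R n d).
Implicit Types (y theta : 'cV[R]_n) (beta u : 'cV[R]_d) (delta : R).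

Definition Yvec (w : Omega D) : 'cV[R]_n := \col_i Y D i w.
Definition EY : 'cV[R]_n := \col_i fine 'E_(Pr D)[Y D i].
Definition covY : 'M[R]_n := \matrix_(i, j) fine (covariance (Pr D) (Y D i) (Y D j)).

Definition linpred beta : 'cV[R]_n := X D *m beta.

(* quasi-log-likelihood y^T X beta - 1^T b(X beta) *)
Definition qll y beta : R :=
  (y^T *m linpred beta) 0 0 - \sum_i b (linpred beta i 0).

(* The constant of proportionality of the working density, which must not depend
   on beta, is absorbed in the measures [base]. *)
Definition working_dens y beta : R := expR (qll y beta).
Definition working_dens1 (theta z : R) : R := expR (z * theta - b theta).

Definition true_dens y : R := \prod_i dens D i (y i 0).

(* Kullback-Leibler divergence of the working model from the true model, as an
   expectation under the true distribution of Y *)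
Definition KL beta : \bar R :=
  'E_(Pr D)[fun w => ln (true_dens (Yvec w) / working_dens (Yvec w) beta)].

Definition Sigma theta : 'M[R]_n := diag_mx (\row_i derive1n 2 b (theta i 0)).

Definition Bmx : 'M[R]_d := (X D)^T *m covY *m X D.
Definition Amx beta : 'M[R]_d := (X D)^T *m Sigma (linpred beta) *m X D.
Definition Vmx beta : 'M[R]_d := isqrtmx Bmx *m Amx beta *m isqrtmx Bmx.
Definition Hmx : 'M[R]_d := invmx (Amx (beta0 D)) *m Bmx.

Definition hmap beta : 'cV[R]_d := sqrtmx (n%:R^-1 *: Bmx) *m beta.
Definition hinv u : 'cV[R]_d := isqrtmx (n%:R^-1 *: Bmx) *m u.

Definition nbhd delta : set 'cV[R]_d :=
  [set beta | norm2 (hmap (beta - beta0 D)) <=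
              (n%:R / d%:R) `^ (- 2^-1) * delta].

(* maximum over [nbhd (2 delta)] of the spectral deviation of V from V(beta_0) *)
Definition rho delta : \bar R :=
  ereal_sup [set (Num.max `|lambda_min (Vmx beta - Vmx (beta0 D))|
                          `|lambda_max (Vmx beta - Vmx (beta0 D))|)%:E
            | beta in nbhd (2 * delta)].

Definition qresid (w : Omega D) : 'cV[R]_n := isqrtmx covY *m (Yvec w - EY).

Definition log_marginal y : R :=
  ln (alpha D * \int[lebesgue_tuple d]_t
        (expR (qll y (hinv (cvec t))) * prior D (cvec t))).

Definition is_qmle (bhat : 'cV[R]_n -> 'cV[R]_d) :=
  forall y beta, qll y beta <= qll y (bhat y).

Definition true_model :=
  [/\ mutually_independent (Pr D) (Y D),
      forall i, measurable_fun setT (dens D i) /\ (forall z, 0 <= dens D i z),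
      forall i (A : set R), measurable A ->
        Pr D (Y D i @^-1` A) = (\int[base D i]_(z in A) (dens D i z)%:E)%E &
      (* needed for cov(Y)^{-1/2} *)
      covY \in unitmx].

Definition working_model :=
  [/\ (0 < d)%N, \rank (X D) = d &
      forall i beta,
        (\int[base D i]_z (working_dens1 (linpred beta i 0) z)%:E = 1)%E].

(* beta0 is the minimizer, i.e. the unique one; KL takes values in \bar R, so this
   also makes the minimum finite, and X^T (EY - mu(X beta0)) = 0 is a consequence *)
Definition KL_minimizer := forall beta, beta != beta0 D -> (KL (beta0 D) < KL beta)%E.

Definition prior_model :=
  [/\ 0 < alpha D <= 1,
      measurable_fun setT (fun t : d.-tuple (measurableTypeR R) => prior D (cvec t)),
      forall u, 0 <= prior D u &
      (\int[lebesgue_tuple d]_t (prior D (cvec t))%:E = 1)%E].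

Definition glm_setting :=
  [/\ true_model, working_model, KL_minimizer & prior_model].

End glm.

Section asymptotics.
Context {R : realType} (b : R -> R) (d : nat -> nat)
  (D : forall n, glm_data R n (d n)).

(* C^2 with b'' bounded away from 0; b being convex, this is a positive lower
   bound on b'', which in turn implies convexity *)
Definition cumulant_function :=
  [/\ forall x, derivable b x 1,
      forall x, derivable (derive1 b) x 1,
      continuous (derive1n 2 b) &
      exists2 k : R, 0 < k & forall x, k <= derive1n 2 b x].

Definition second_moments_bounded :=
  exists K : R, forall n, (0 < n)%N -> forall i : 'I_n,
    ('E_(Pr (D n))[fun w => (Y (D n) i w ^+ 2)%R] <= K%:E)%E.

Definition delta_seq (c0 r : R) (n : nat) : R :=
  n%:R `^ r * Num.sqrt (c0 * ln n%:R).

Definition subgaussian_condition (H : R) :=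
  0 < H /\ forall n, (0 < n)%N -> forall (i : 'I_n) (t : R), 0 <= t ->
    (Pr (D n) [set w | (t < `|qresid w i 0|)%R] <= (H * expR (- t ^+ 2 / H))%:E)%E.

Definition curvature_condition (H c0 c1 r : R) :=
  [/\ [/\ 0 < c1, 8 * c1 ^- 2 * H < c0 & 0 < r < 4^-1],
      \forall n \near \oo, forall beta, nbhd (D n) (delta_seq c0 r n) beta ->
        c1 * n%:R `^ (- r) < lambda_min (Vmx b (D n) beta),
      (d n)%:R * delta_seq c0 r n ^+ 2 / lambda_min (Bmx (D n))
        @[n --> \oo] --> (0 : R) &
      (d n)%:R / (n%:R `^ ((1 - 4 * r) / 3) * (ln n%:R) `^ (- (2 / 3)))
        @[n --> \oo] --> (0 : R)].

Definition lyapunov_condition :=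
  (\sum_(i < n) ((row i (X (D n)) *m invmx (Bmx (D n)) *m (row i (X (D n)))^T) 0 0)
      `^ (3 / 2) @[n --> \oo] --> (0 : R)) /\
  exists K : R, forall n, (0 < n)%N -> forall i : 'I_n,
    ('E_(Pr (D n))[fun w => (`|Y (D n) i w - EY (D n) i 0| ^+ 3)%R] <= K%:E)%E.

Definition prior_condition (c0 r c2 c3 : R) :=
  [/\ 0 < c2 /\ 0 < c3,
      forall n, (0 < n)%N -> forall beta,
        nbhd (D n) (2 * delta_seq c0 r n) beta ->
        c2 <= prior (D n) (hmap (D n) beta),
      forall n, (0 < n)%N -> forall beta, prior (D n) (hmap (D n) beta) <= c3 &
      (rho b (D n) (delta_seq c0 r n) * (n%:R `^ ((1 - r) / 3))%:E
        @[n --> \oo] --> 0)%E].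

End asymptotics.

(* Main.v *)
Require Import Defs.
From HB Require Import structures.
From mathcomp Require Import all_boot all_order all_algebra.
From mathcomp Require Import complex.
From mathcomp Require Import all_classical all_reals all_analysis.
From mathcomp Require Import measurable_realfun.
From mathcomp Require Import ring lra.

(** The quasi-log-likelihood [l] of a generalized linear model with canonical
    link has a Hessian that does not depend on the observation: it is minus
    [A(beta) = Amx b D beta].  Only the gradient of [l] is random.  Write
    [B = Bmx D], [A0 = A(beta0)], [kappa = c1 n^-r] and [delta = delta_seq c0 r n],
    so that [nbhd D delta] is the ball of squared radius [r2 = d delta^2] around
    [beta0] in the norm of [B], and [A(beta) >= kappa B] there.

    Localization.  The minimizer of the Kullback-Leibler divergence is a
    maximizer of the mean of [l] ([mean_qll_max]).  On the sphere of squared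
    radius [r2] the mean of [l] has therefore dropped by at least
    [kappa r2 / 2], while [l] minus its mean changes by a linear function of the
    displacement, bounded through Cauchy-Schwarz by the square root of
    [score2 * r2].  The expectation of [score2] is the trace of an identity
    matrix, that is [d], so by Markov's inequality the random part is too small
    to compensate with probability tending to one, because [kappa delta] tends
    to infinity ([prob_small_score]).  By concavity the maximizer [bh] of [l] is
    then in the ball ([qmle_in_ball]).

    Laplace approximation.  Put [Q = qform A0 (beta - bh)], [eps = rho / kappa]
    and [T^2 = kappa r2].  On the ball of squared radius [r2] around [bh],
    [l - l(bh)] is between [- (1 + eps) Q / 2] and [- (1 - eps) Q / 2].  Outside
    the ball, concavity along the rays from [bh] turns the quadratic decrease
    reached on the sphere into a decrease at least linear in [sqrt Q]
    ([qll_outside_le]).  Integrating these bounds with the prior density, which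
    is at most [c3] everywhere and at least [c2] on the ball, gives the Gaussian
    integral of [exp (- Q / 2)] up to a factor between [c2 * lo] and [c3 * up]
    ([laplace_lower], [laplace_upper]).  The Gaussian integral, written in the
    variable [h(beta)], is [(2 pi)^(d/2) n^(-d/2) |H_n|^(1/2)]; its logarithm is
    the sum of the deterministic terms of the expansion
    ([log_marginal_expansion]).

    Rates.  The factors [lo] and [up] tend to one as soon as [d eps] tends to
    zero and [T^2 / d = kappa delta^2] tends to infinity ([lower_factor],
    [upper_factor]).  The first holds because [d = O(n^((1 - 4r)/3))] and
    [rho = o(n^(-(1 - r)/3))] ([relative_error_rate]), the second because
    [kappa delta^2] is at least a multiple of [ln n].  A number between
    [c2 * lo] and [c3 * up] is [c * exp rem] with [c] in [[c2, c3]] and [rem]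
    small ([clamp_ln]).

    Two tools are built on the way.  The spectral theorem over an algebraically
    closed field is brought down to real symmetric matrices; it yields the
    matrix square roots and the variational meaning of the extreme eigenvalues.
    Integrals of functions of a quadratic form over tuples are reduced to
    one-dimensional ones by a Cholesky factorization performed together with
    Fubini's theorem. *)

Set Implicit Arguments.
Unset Strict Implicit.
Unset Printing Implicit Defensive.

Import Order.TTheory GRing.Theory Num.Theory.
Import numFieldNormedType.Exports.

Local Open Scope classical_set_scope.
Local Open Scope ring_scope.

(** * Real symmetric matrices: spectral form, square roots, extreme eigenvalues *)

(** Used to realize the square root of a symmetric matrix as a polynomial in that
    matrix, so that it inherits realness and symmetry. *)
Lemma interpolation (F : fieldType) (s : seq F) (g : F -> F) :
  exists p : {poly F}, forall x, x \in s -> p.[x] = g x.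
Proof.
elim: s => [|x s [p pP]]; first by exists 0.
case: (boolP (x \in s)) => xs.
  by exists p => y; rewrite inE => /orP[/eqP ->|]; exact: pP.
pose q := \prod_(y <- s) ('X - y%:P).
have qx : q.[x] != 0.
  rewrite horner_prod prodf_seq_neq0; apply/allP => y ys /=.
  by rewrite hornerXsubC subr_eq0; apply: contraNneq xs => ->.
exists (p + ((g x - p.[x]) / q.[x]) *: q) => y; rewrite inE hornerD hornerZ => /orP[/eqP ->|ys].
  by rewrite divfK // addrC subrK.
rewrite pP // (_ : q.[y] = 0) ?mulr0 ?addr0 //.
by rewrite horner_prod (big_rem y) //= hornerXsubC subrr mul0r.
Qed.

Lemma horner_conj_diag (F : fieldType) n (P : 'M[F]_n.+1) (s : 'rV_n.+1) p :
  P \in unitmx ->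
  horner_mx (invmx P *m diag_mx s *m P) p =
  invmx P *m diag_mx (map_mx (horner p) s) *m P.
Proof.
move=> uP; rewrite -[X in _ *m X]invmxK horner_mx_uconj ?unitmx_inv //.
by rewrite invmxK horner_mx_diag.
Qed.

Section quadratic_forms.
Local Open Scope sesquilinear_scope.
Context {R : realType}.

Definition qform n (A : 'M[R]_n) (v : 'cV[R]_n) : R := (v^T *m A *m v) 0 0.

Definition pdmx n (A : 'M[R]_n) :=
  A^T = A /\ forall v : 'cV[R]_n, v != 0 -> 0 < qform A v.

Lemma qformE n (A : 'M[R]_n) v :
  qform A v = \sum_i \sum_j A i j * (v i 0 * v j 0).
Proof.
rewrite /qform -mulmxA mxE; apply: eq_bigr => i _.
by rewrite !mxE mulr_sumr; apply: eq_bigr => j _; rewrite mulrCA mulrA.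
Qed.

(** Diagonalize the image of [A] over [C] by a unitary matrix [P].  The number [W v i]
    is the squared modulus of the [i]-th coordinate of [P v], hence real, and a
    polynomial in [A] acts on these coordinates by its values at the
    eigenvalues.  Stating this with real data only, for polynomials in [A],
    avoids constructing a real orthonormal eigenbasis. *)
Lemma spectral_descent (C : numClosedFieldType) (f : {rmorphism R -> C})
    (re : C -> R) n (A : 'M[R]_n.+1) :
  (forall x, f x \is Num.real) -> (forall z, z \is Num.real -> f (re z) = z) ->
  (forall x, (0 <= f x) = (0 <= x)) ->
  A^T = A ->
  exists (D : 'I_n.+1 -> R) (W : 'cV[R]_n.+1 -> 'I_n.+1 -> R),
  [/\ forall i, eigenvalue A (D i),
      forall v i, 0 <= W v i,
      forall p v, qform (horner_mx A p) v = \sum_i p.[D i] * W v i &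
      forall p, (forall i, p.[D i] = 0) -> horner_mx A p = 0].
Proof.
move=> freal reK fge0 symA.
pose AC := map_mx f A; pose P := spectralmx AC; pose sp := spectral_diag AC.
have fmxreal m k (M : 'M[R]_(m, k)) : map_mx f M \is a mxOver Num.real.
  by apply/mxOverP => i j; rewrite mxE.
have hA : AC \is hermsymmx.
  apply: realsym_hermsym; last exact: fmxreal.
  apply/is_hermitianmxP; rewrite expr0 scale1r map_mx_id //.
  by rewrite /AC map_trmx symA.
have uP : P \is unitarymx by exact: spectral_unitarymx.
have ACE : AC = invmx P *m diag_mx sp *m P.
  exact/orthomx_spectralP/hermitian_normalmx.
have spreal : sp \is a mxOver Num.real by exact: hermitian_spectral_diag_real.
pose D i := re (sp 0 i).
have spD i : sp 0 i = f (D i).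
  by rewrite /D reK //; exact/mxOverP.
have hornerE p : map_mx f (horner_mx A p) =
    invmx P *m diag_mx (map_mx f (\row_i p.[D i])) *m P.
  rewrite map_horner_mx -/AC ACE horner_conj_diag ?spectral_unit //.
  congr (_ *m diag_mx _ *m _); apply/rowP => i.
  by rewrite !mxE spD horner_map.
pose W (v : 'cV[R]_n.+1) i := re (`|(P *m map_mx f v) i 0| ^+ 2).
have WE v i : f (W v i) = `|(P *m map_mx f v) i 0| ^+ 2.
  by rewrite /W reK // ger0_real // exprn_ge0.
exists D, W; split.
- move=> i; have <- : eigenvalue AC (sp 0 i) = eigenvalue A (D i).
    by rewrite spD; exact: eigenvalue_map.
  apply/eigenvalueP; exists (row i P); last first.
    apply: contraTneq (spectral_unit AC) => rP0.
    rewrite -row_free_unit; apply/negP => /row_freeP[B PB].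
    have /(congr1 (row i)) := PB.
    rewrite row_mul [row i _]rP0 mul0mx => /matrixP/(_ 0 i)/eqP.
    by rewrite !mxE eqxx eq_sym oner_eq0.
  rewrite -row_mul ACE !mulmxA mulmxV ?spectral_unit // mul1mx.
  by rewrite row_mul row_diag_mx -scalemxAl -rowE.
- by move=> v i; rewrite -fge0 WE exprn_ge0.
- move=> p v; apply: (fmorph_inj f); rewrite rmorph_sum /=.
  transitivity ((map_mx f v^T *m map_mx f (horner_mx A p) *m map_mx f v) 0 0).
    by rewrite -!map_mxM mxE.
  rewrite hornerE invmx_unitary //.
  have -> : map_mx f v^T = (map_mx f v) ^t*.
    by apply/matrixP => i j; rewrite !mxE; apply/esym/CrealP.
  rewrite !mulmxA -map_mxM -trmx_mul -mulmxA mxE.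
  apply: eq_bigr => i _.
  rewrite mul_mx_diag rmorphM /= WE normCK.
  rewrite ![in LHS]mxE [(P *m _) i 0]mxE mulrAC mulrC; congr (_ * _).
  exact: mulrC.
- move=> p p0.
  have /eqP : map_mx f (horner_mx A p) = 0.
    rewrite hornerE (_ : (\row_i _) = 0).
      by rewrite map_mx0 raddf0 mulmx0 mul0mx.
    by apply/rowP => i; rewrite !mxE p0.
  by rewrite map_mx_eq0 => /eqP.
Qed.

Lemma real_spectral n (A : 'M[R]_n.+1) : A^T = A ->
  exists (D : 'I_n.+1 -> R) (W : 'cV[R]_n.+1 -> 'I_n.+1 -> R),
  [/\ forall i, eigenvalue A (D i),
      forall v i, 0 <= W v i,
      forall p v, qform (horner_mx A p) v = \sum_i p.[D i] * W v i &
      forall p, (forall i, p.[D i] = 0) -> horner_mx A p = 0].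
Proof.
apply: (@spectral_descent _ (real_complex R) (@complex.Re R)) => //.
- by move=> x; apply/complex_realP; exists x.
- exact: RRe_real.
- exact: ler0c.
Qed.

Lemma qform1 n (v : 'cV[R]_n) : qform 1%:M v = \sum_i v i 0 ^+ 2.
Proof. by rewrite /qform mulmx1 mxE; apply: eq_bigr => i _; rewrite !mxE. Qed.

Lemma qform1_gt0 n (v : 'cV[R]_n) : v != 0 -> 0 < qform 1%:M v.
Proof.
move=> v0; rewrite qform1 lt_def sumr_ge0 ?andbT => [|i _]; last exact: sqr_ge0.
apply: contra v0 => /eqP sum0; apply/eqP/colP => i; rewrite mxE.
apply/eqP; rewrite -sqrf_eq0; apply/eqP.
by apply: (psumr_eq0P _ sum0) => // j _; exact: sqr_ge0.
Qed.

Lemma horner_mx_sym n (A : 'M[R]_n.+1) p : A^T = A ->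
  (horner_mx A p)^T = horner_mx A p.
Proof.
move=> symA; elim/poly_ind: p => [|p c IH]; first by rewrite rmorph0 trmx0.
rewrite rmorphD rmorphM /= horner_mx_X horner_mx_C linearD /= tr_scalar_mx.
by rewrite trmx_mul IH symA; congr (_ + _); exact/esym/comm_horner_mx.
Qed.

(** The polynomial interpolating [sqrt] at the eigenvalues of [A], evaluated at [A]. *)
Lemma psdmx_sqrt n (A : 'M[R]_n) : psdmx A ->
  psdmx (sqrtmx A) /\ sqrtmx A *m sqrtmx A = A.
Proof.
move=> [symA Age0]; suff [S SP] : exists S, psdmx S /\ S *m S = A.
  exact: (@xgetPex _ 0 [set S | psdmx S /\ S *m S = A]) (ex_intro _ S SP).
case: n A symA Age0 => [|n] A symA Age0.
  exists 0; split; last by apply/matrixP => -[].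
  by split=> [|v]; [exact: trmx0|rewrite mulmx0 mul0mx mxE].
have [D [W [DA W0 WE hA0]]] := real_spectral symA.
have D0 i : 0 <= D i.
  have /eigenvalueP[v vA v0] := DA i.
  have vT0 : v^T != 0 by rewrite -(inj_eq trmx_inj) trmxK trmx0.
  have := Age0 v^T; rewrite trmxK vA -scalemxAl mxE.
  rewrite pmulr_lge0 //.
  by have := qform1_gt0 vT0; rewrite /qform trmxK mulmx1.
have [p pE] := interpolation (codom D) Num.sqrt.
have {}pE i : p.[D i] = Num.sqrt (D i) by apply/pE/codom_f.
exists (horner_mx A p); split; first split.
- exact: horner_mx_sym.
- move=> v; rewrite -/(qform _ _) WE; apply: sumr_ge0 => i _.
  by rewrite pE mulr_ge0 // sqrtr_ge0.
- have : horner_mx A (p * p - 'X) = 0.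
    by apply: hA0 => i; rewrite !hornerE pE -expr2 sqr_sqrtr // subrr.
  by rewrite rmorphB rmorphM /= horner_mx_X => /eqP; rewrite subr_eq0 => /eqP.
Qed.

(** Averaging the eigenvalues with the weights [W v i] of [real_spectral], whose sum
    is the squared norm of [v]. *)
Lemma lambda_minP n (A : 'M[R]_n) v : A^T = A ->
  lambda_min A * qform 1%:M v <= qform A v.
Proof.
case: n A v => [|n] A v symA.
  by rewrite (_ : v = 0) ?/qform ?mulmx0 ?mxE ?mulr0 //; apply/matrixP => -[].
have [D [W [DA W0 WE _]]] := real_spectral symA.
have h1 u : qform 1%:M u = \sum_i W u i.
  have := WE 1 u; rewrite rmorph1 => ->.
  by apply: eq_bigr => i _; rewrite hornerE mul1r.
have hA u : qform A u = \sum_i D i * W u i.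
  by rewrite -{1}(horner_mx_X A) WE; under eq_bigr do rewrite hornerX.
rewrite h1 hA mulr_sumr; apply: ler_sum => i _.
rewrite ler_wpM2r //; apply: ge_inf; last exact: DA.
(* the infimum defining [lambda_min] needs a lower bound of the spectrum *)
exists (- \sum_j `|D j|) => a /eigenvalueP[u uA u0].
have uT0 : u^T != 0 by rewrite -(inj_eq trmx_inj) trmxK trmx0.
have u1 := qform1_gt0 uT0.
have qu : qform A u^T = a * qform 1%:M u^T.
  by rewrite /qform trmxK uA mulmx1 -scalemxAl mxE.
rewrite -(ler_pM2r u1) -qu h1 hA mulr_sumr; apply: ler_sum => j _.
rewrite ler_wpM2r // lerNl (bigD1 j) //= ler_wpDr ?sumr_ge0 //.
by rewrite -normrN ler_norm.
Qed.

Lemma lambda_maxP n (A : 'M[R]_n) v : A^T = A ->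
  qform A v <= lambda_max A * qform 1%:M v.
Proof.
move=> symA; have symNA : (- A)^T = - A by rewrite linearN /= symA.
have -> : lambda_max A = - lambda_min (- A).
  rewrite /lambda_min /inf opprK; congr sup; apply/seteqP; split => a /=.
    move=> /eigenvalueP[u uA u0]; exists (- a); rewrite ?opprK //=.
    by apply/eigenvalueP; exists u => //; rewrite mulmxN uA scaleNr.
  move=> [c /= /eigenvalueP[u uA u0] <-].
  by apply/eigenvalueP; exists u => //; rewrite -[A]opprK mulmxN uA scaleNr.
rewrite mulNr lerNr; apply: le_trans (lambda_minP v symNA) _.
by rewrite /qform mulmxN mulNmx mxE.
Qed.

End quadratic_forms.

(** * Lebesgue measure on tuples under affine maps *)

Section lebesgue_integrals.
Context {R : realType}.
Local Notation RR := (measurableTypeR R).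
Local Notation mu := lebesgue_measure.

(** Lebesgue measure is [a] times its image under the affine map, since both agree on
    intervals. *)
Lemma integral_affine (f : R -> \bar R) (a c : R) : 0 < a ->
  measurable_fun setT f -> (forall x, 0 <= f x)%E ->
  (\int[mu]_x f (a * x + c)%R = (a^-1)%:E * \int[mu]_x f x)%E.
Proof.
move=> a0 mf f0; pose phi : RR -> RR := fun x => a * x + c.
have mphi : measurable_fun setT phi.
  by apply: measurable_funD => //; exact: measurable_funM.
pose nu : {measure set RR -> \bar R} :=
  measure_function_pushforward__canonical__measure_function_Measure mu mphi.
pose k : {nonneg R} := NngNum (ltW a0).
have E A : measurable A -> mu A = mscale k nu A.
  apply: lebesgue_measure_unique => _ [[x y] /= xy <-].
  rewrite /mscale /= /pushforward.
  have -> : phi @^-1` `]x, y] = `]((x - c) / a), ((y - c) / a)]%classic.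
    apply/seteqP; split => z /=; rewrite !in_itv /= /phi;
      by rewrite ltr_pdivrMr// ler_pdivlMr// ltrBlDr lerBrDr (mulrC a).
  rewrite !lebesgue_measure_itv /= !lte_fin ltr_pM2r ?invr_gt0 // ltrD2r.
  case: ifP => _; last by rewrite mule0.
  rewrite -!EFinD -EFinM; congr EFin.
  by field; rewrite gt_eqF.
have -> : (\int[mu]_x f x = \int[mscale k nu]_x f x)%E.
  by apply: eq_measure_integral => A mA _; exact: E.
rewrite ge0_integral_mscale //= ge0_integral_pushforward //.
by rewrite muleA -EFinM mulVf ?gt_eqF // mul1e.
Qed.

(** Fubini-Tonelli for the first coordinate. *)
Lemma integral_tcons n (F : n.+1.-tuple RR -> \bar R) :
  measurable_fun setT F -> (forall t, 0 <= F t)%E ->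
  measurable_fun setT (fun t => \int[mu]_x F (tcons (x, t)))%E /\
  (\int[lebesgue_tuple n.+1]_t F t =
   \int[lebesgue_tuple n]_t \int[mu]_x F (tcons (x, t)))%E.
Proof.
move=> mF F0.
have mFc : measurable_fun setT (F \o @tcons R n).
  by apply: measurableT_comp => //; exact: measurable_tcons.
have F0c p : (0 <= (F \o @tcons R n) p)%E by exact: F0.
split.
  exact (@measurable_fun_fubini_tonelli_G _ _ _ _ R mu _ mFc F0c).
rewrite /= /leb_step.
rewrite (ge0_integral_pushforward (@measurable_tcons R n)) //.
rewrite preimage_setT.
exact (@fubini_tonelli2 _ _ _ _ R mu (lebesgue_tuple n) _ mFc F0c).
Qed.

Definition vtup n (v : 'cV[R]_n) : n.-tuple RR := [tuple v i 0 | i < n].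

Lemma cvecK n : cancel (@cvec R n) (@vtup n).
Proof. by move=> t; apply: eq_from_tnth => i; rewrite tnth_mktuple mxE. Qed.

Lemma vtupK n : cancel (@vtup n) (@cvec R n).
Proof. by move=> v; apply/colP => i; rewrite mxE tnth_mktuple. Qed.

Lemma cvec_tcons n (x : R) (t : n.-tuple RR) :
  cvec (tcons (x, t)) = col_mx (x%:M : 'cV_1) (cvec t).
Proof.
apply/colP => i; rewrite !mxE; case: splitP => j ij; rewrite !mxE.
  by rewrite (_ : i = ord0) ?ord1 //; apply/val_inj; rewrite /= ij ord1.
rewrite (_ : i = lift ord0 j); last by apply/val_inj; rewrite /= ij.
by rewrite /tcons tnthS.
Qed.

Lemma vtup_col_mx n (s : R) (v : 'cV[R]_n) :
  vtup (col_mx (s%:M : 'cV_1) v) = tcons (s, vtup v).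
Proof.
by apply: (can_inj (@cvecK n.+1)); rewrite cvec_tcons !vtupK.
Qed.

Lemma measurable_vtup_affine m n (L : 'M[R]_(m, n)) (a : 'cV[R]_m) :
  measurable_fun setT (fun t : n.-tuple RR => vtup (L *m cvec t + a)).
Proof.
apply/measurable_fun_tnthP => i /=.
rewrite (_ : _ \o _ = fun t => \sum_j L i j * tnth t j + a i 0); last first.
  apply/funext => t /=; rewrite tnth_mktuple !mxE; congr (_ + _).
  by apply: eq_bigr => j _; rewrite mxE.
apply: measurable_funD => //; apply: measurable_sum => j.
by apply: measurable_funM => //; exact: measurable_tnth.
Qed.

(** An affine change of variables by an upper triangular factor [L] of [M], obtained
    without any measure theory of linear maps: [L] acts on the first coordinate
    by a one-dimensional affine map whose offset depends on the other
    coordinates, so Fubini and [integral_affine] remove that coordinate, and the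
    induction hypothesis applies to the Schur complement of the corner of [M]. *)
Lemma cholesky_integral n (M : 'M[R]_n) : pdmx M ->
  exists L : 'M[R]_n, [/\ L^T *m L = M, 0 < \det L &
    forall (F : n.-tuple RR -> \bar R) (a : 'cV[R]_n),
      measurable_fun setT F -> (forall t, 0 <= F t)%E ->
      (\int[lebesgue_tuple n]_t F (vtup (L *m cvec t + a)%R) =
       ((\det L)^-1)%:E * \int[lebesgue_tuple n]_t F t)%E].
Proof.
elim: n M => [|n IH] M [symM posM].
  exists 0; rewrite det_mx00; split=> //; first by apply/matrixP => -[].
  move=> F a mF F0; rewrite invr1 mul1e; apply: eq_integral => t _.
  by congr F; apply: eq_from_tnth => -[].
move: M symM posM; change n.+1 with (1 + n)%N => M symM posM.
pose m11 := M 0 0; pose u := dlsubmx M; pose N := drsubmx M.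
have ME : M = block_mx (m11%:M) u^T u N.
  rewrite -[LHS]submxK; congr block_mx.
    by apply/matrixP => i j; rewrite !ord1 !mxE /=; congr (M _ _); apply/val_inj.
  by rewrite /u trmx_dlsub symM.
have symN : N^T = N by rewrite /N trmx_drsub symM.
have m11_gt0 : 0 < m11.
  have : col_mx (1%:M : 'cV[R]_1) (0 : 'cV_n) != 0.
    apply/eqP => /colP/(_ (lshift n 0)); rewrite col_mxEu !mxE eqxx => /eqP.
    by rewrite oner_eq0.
  move=> /posM; rewrite /qform ME tr_col_mx mul_row_block mul_row_col.
  by rewrite !trmx0 !mul0mx mulmx0 !addr0 trmx1 mul1mx mulmx1 mxE eqxx.
pose s := Num.sqrt m11.
have s0 : 0 < s by rewrite sqrtr_gt0.
have ss : s * s = m11 by rewrite -expr2 sqr_sqrtr // ltW.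
(* the Schur complement of the corner [m11] *)
pose S := N - m11^-1 *: (u *m u^T).
have pdS : pdmx S.
  split; first by rewrite /S linearB linearZ /= trmx_mul trmxK symN.
  move=> v v0; pose c := (u^T *m v) 0 0.
  have cE : u^T *m v = c%:M by exact: mx11_scalar.
  have cE' : v^T *m u = c%:M.
    by rewrite -[LHS]trmxK trmx_mul trmxK cE tr_scalar_mx.
  (* the first coordinate minimizing the form, the others being those of [v] *)
  pose x : 'cV[R]_1 := (- c / m11)%:M.
  have : col_mx x v != 0.
    by apply: contra v0 => /eqP/(congr1 dsubmx); rewrite col_mxKd linear0 => ->.
  move=> /posM; suff -> : qform M (col_mx x v) = qform S v by [].
  rewrite /qform ME tr_col_mx mul_row_block mul_row_col tr_scalar_mx.
  rewrite /S mulmxBr mulmxBl -scalemxAr -scalemxAl !mulmxA cE' !mulmxDl.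
  rewrite -!(mulmxA _ u^T v) cE -!scalar_mxM -!raddfD /= addrA -raddfD /=.
  rewrite scale_scalar_mx [RHS]mxE [LHS]mxE addrC; congr (_ + _).
  by rewrite !mxE /= mulr1n -mulNr; field; rewrite gt_eqF.
have [L' [LL' detL' chL']] := IH _ pdS.
pose L : 'M[R]_(1 + n) := block_mx s%:M (s^-1 *: u^T) 0 L'.
have detL : \det L = s * \det L' by rewrite /L det_ublock det_scalar1.
exists L; split.
- rewrite /L tr_block_mx mulmx_block ME !trmx0 tr_scalar_mx. 
  have -> : (s^-1 *: u^T)^T = s^-1 *: u by rewrite linearZ /= trmxK.
  rewrite !mulmx0 !mul0mx !addr0 -scalar_mxM ss mul_scalar_mx mul_mx_scalar.
  rewrite !scalerA mulfV ?gt_eqF // !scale1r -scalemxAl -scalemxAr scalerA LL'.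
  by rewrite -invfM ss /S addrC subrK.
- by rewrite detL mulr_gt0.
move=> F a mF F0.
have Ltcons x t : vtup (L *m cvec (tcons (x, t)) + a) =
    tcons (s * x + (s^-1 * (u^T *m cvec t) 0 0 + a 0 0),
           vtup (L' *m cvec t + dsubmx a)).
  rewrite -vtup_col_mx cvec_tcons; congr vtup.
  rewrite -{1}[a]vsubmxK mul_block_col mul0mx add0r add_col_mx; congr col_mx.
  rewrite [usubmx a]mx11_scalar -scalar_mxM -scalemxAl.
  rewrite [u^T *m cvec t]mx11_scalar scale_scalar_mx -!raddfD /=; congr (_%:M).
  by rewrite -addrA !mxE eqxx mulr1n; congr (_ + (_ + a _ 0)); apply/val_inj.
have mFL : measurable_fun setT (fun t => F (vtup (L *m cvec t + a))).
  by apply: (measurableT_comp mF); exact: measurable_vtup_affine.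
have [_ ->] := integral_tcons mFL (fun t => F0 _).
have [mG ->] := integral_tcons mF F0.
have mFx t : measurable_fun setT (fun x : R => F (tcons (x, t))).
  apply: (measurableT_comp mF).
  apply: measurableT_comp; first exact: measurable_tcons.
  exact: measurable_pair2.
under eq_integral => t _.
  under eq_integral do rewrite Ltcons.
  rewrite (integral_affine (f := fun x => F (tcons (x, vtup (L' *m cvec t + dsubmx a)))))  //.
  over.
have mGL : measurable_fun setT
    (fun t => \int[mu]_x F (tcons (x, vtup (L' *m cvec t + dsubmx a))))%E.
  by apply: (measurableT_comp mG); exact: measurable_vtup_affine.
rewrite (ge0_integralZl _ measurableT mGL); last 2 first.
- by move=> t _; apply: integral_ge0.
- by rewrite lee_fin invr_ge0 ltW.
rewrite (chL' (fun t => \int[mu]_x F (tcons (x, t)))%E) //; last first.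
  by move=> t; apply: integral_ge0.
by rewrite muleA -EFinM detL invfM.
Qed.

Lemma measurable_prod_tnth n (g : R -> R) : measurable_fun setT g ->
  measurable_fun setT (fun t : n.-tuple RR => (\prod_i g (tnth t i))%:E).
Proof.
move=> mg; apply/measurable_EFinP; apply: measurable_prod => i _.
by apply: (measurableT_comp mg); exact: measurable_tnth.
Qed.

(** Fubini-Tonelli, one coordinate at a time. *)
Lemma integral_prod n (g : R -> R) (c : R) : measurable_fun setT g ->
  (forall x, 0 <= g x) -> (\int[mu]_x (g x)%:E = c%:E)%E ->
  (\int[lebesgue_tuple n]_t (\prod_i g (tnth t i))%:E = (c ^+ n)%:E)%E.
Proof.
move=> mg g0 gc; have c0 : 0 <= c.
  by rewrite -lee_fin -gc; apply: integral_ge0 => x _; rewrite lee_fin.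
elim: n => [|n IH].
  rewrite /= integral_dirac //; last exact: measurable_prod_tnth.
  by rewrite diracT mul1e big_ord0 expr0.
have pg0 m (t : m.-tuple RR) : (0 <= (\prod_i g (tnth t i))%:E)%E.
  by rewrite lee_fin; apply: prodr_ge0.
have [_ ->] := integral_tcons (measurable_prod_tnth (n := n.+1) mg) (pg0 _).
under eq_integral => t _.
  under eq_integral => x _.
    rewrite big_ord_recl /tcons /= tnth0.
    under eq_bigr do rewrite tnthS.
    rewrite mulrC EFinM; over.
  rewrite ge0_integralZl //; last 3 first.
  - exact/measurable_EFinP.
  - by move=> x _; rewrite lee_fin.
  - by rewrite lee_fin; apply: prodr_ge0.
  rewrite gc muleC; over.
rewrite ge0_integralZl //; last 2 first.
- exact: measurable_prod_tnth.
- by move=> t _; exact: pg0.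
by rewrite IH -EFinM exprS.
Qed.

Lemma integral_gaussian (s : R) : 0 < s ->
  (\int[mu]_x (expR (- (s / 2) * x ^+ 2))%:E = (Num.sqrt (2 * pi / s))%:E)%E.
Proof.
move=> s0; have s2 : 0 < Num.sqrt (s / 2) by rewrite sqrtr_gt0 divr_gt0.
under eq_integral => x _.
  rewrite (_ : expR _ = gauss_fun (Num.sqrt (s / 2) * x + 0)); last first.
    by rewrite /gauss_fun addr0 exprMn sqr_sqrtr ?ltW ?divr_gt0 // mulNr.
  over.
rewrite (integral_affine (f := EFin \o gauss_fun)) //; last 2 first.
- by apply/measurable_EFinP; exact: measurable_gauss_fun.
- by move=> x /=; rewrite lee_fin gauss_fun_ge0.
rewrite integralT_gauss -EFinM -sqrtrV ?ltW ?divr_gt0 // -sqrtrM; last first.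
  by rewrite invr_ge0 ltW // divr_gt0.
by congr (Num.sqrt _)%:E; field; rewrite gt_eqF.
Qed.

(** The two-sided exponential is dominated by the exponential density plus its
    reflection. *)
Lemma integral_laplace_le (a : R) : 0 < a ->
  (\int[mu]_x (expR (- a * `|x|))%:E <= (2 / a)%:E)%E.
Proof.
move=> a0; pose p : R -> R := exponential_pdf a.
have mp : measurable_fun setT p by exact: measurable_exponential_pdf.
have p0 x : 0 <= p x by exact/exponential_pdf_ge0/ltW.
have pE x : 0 <= x -> p x = a * expR (- a * x) by exact: exponential_pdfE.
have lep x : expR (- a * `|x|) <= a^-1 * (p x + p (- x)).
  rewrite ler_pdivlMl //; have [x0|x0] := leP 0 x.
    by rewrite ger0_norm // (pE x) // lerDl.
  have Nx0 : 0 <= - x by rewrite oppr_ge0 ltW.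
  by rewrite ltr0_norm // (pE _ Nx0) lerDr.
have mpN : measurable_fun setT (fun x : R => p (- x)).
  by apply: measurableT_comp.
have pN : (\int[mu]_x (p (- x))%:E = \int[mu]_x (p x)%:E)%E.
  have -> : (\int[mu]_x (p x)%:E =
     \int[pushforward mu (-%R : _ -> measurableTypeR R)]_x (p x)%:E)%E.
    by apply: eq_measure_integral => A mA _; rewrite /= lebesgue_measureN.
  rewrite ge0_integral_pushforward //.
    by apply/measurable_EFinP.
  by move=> x _; rewrite lee_fin.
have mlap : measurable_fun setT (fun x : R => (expR (- a * `|x|))%:E).
  apply/measurable_EFinP; apply: measurableT_comp; first exact: measurable_expR.
  by apply: measurable_funM => //; exact: measurableT_comp.
have mpp : measurable_fun setT (fun x : RR => (p x)%:E + (p (- x)%R)%:E)%E.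
  by apply: emeasurable_funD; exact/measurable_EFinP.
apply: (@le_trans _ _ (\int[mu]_x ((a^-1)%:E * ((p x)%:E + (p (- x)%R)%:E)))%E).
  apply: ge0_le_integral.
  - exact: measurableT.
  - by move=> x _; rewrite lee_fin expR_ge0.
  - exact: mlap.
  - by apply: emeasurable_funM; [exact: measurable_cst|exact: mpp].
  - by move=> x _; rewrite -EFinD -EFinM lee_fin.
rewrite (ge0_integralZl _ measurableT mpp); last 2 first.
- by move=> x _; rewrite -EFinD lee_fin addr_ge0.
- by rewrite lee_fin invr_ge0 ltW.
have mpe : measurable_fun setT (fun x : RR => (p x)%:E) by exact/measurable_EFinP.
have mpNe : measurable_fun setT (fun x : RR => (p (- x))%:E) by exact/measurable_EFinP.
rewrite (ge0_integralD _ measurableT _ mpe _ mpNe); last 2 first.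
- by move=> x _; rewrite lee_fin.
- by move=> x _; rewrite lee_fin.
by rewrite pN integral_exponential_pdf // -EFinD -EFinM lee_fin mulrC.
Qed.

End lebesgue_integrals.

(** * Gaussian and exponential integrals of a quadratic form *)

Section gaussian_integrals.
Context {R : realType}.
Local Notation RR := (measurableTypeR R).
Local Notation mu := lebesgue_measure.

Lemma det_sqrt n (L M : 'M[R]_n) : L^T *m L = M -> 0 < \det L ->
  \det L = Num.sqrt (\det M).
Proof.
by move=> <- L0; rewrite det_mulmx det_tr -expr2 sqrtr_sqr gtr0_norm.
Qed.

Lemma pdmx_det_gt0 n (M : 'M[R]_n) : pdmx M -> 0 < \det M.
Proof.
move=> /cholesky_integral[L [<- L0 _]].
by rewrite det_mulmx det_tr mulr_gt0.
Qed.

(** With [M = L^T L] the form [M] at [v] is the squared norm of [L v]; then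
    [cholesky_integral] applies. *)
Lemma integral_radial n (M : 'M[R]_n) (m : 'cV[R]_n) (g : R -> R) : pdmx M ->
  measurable_fun setT g -> (forall x, 0 <= g x) ->
  (\int[lebesgue_tuple n]_t (g (qform M (cvec t - m)))%:E =
   (Num.sqrt (\det M))^-1%:E *
   \int[lebesgue_tuple n]_t (g (\sum_i tnth t i ^+ 2))%:E)%E.
Proof.
move=> /cholesky_integral[L [LM L0 chL]] mg g0.
rewrite -(det_sqrt LM L0).
rewrite -(chL (fun t => (g (\sum_i tnth t i ^+ 2))%:E) (- (L *m m))); last 2 first.
- apply/measurable_EFinP; apply: (measurableT_comp mg).
  apply: measurable_sum => i; apply: measurable_funX.
  exact: measurable_tnth.
- by move=> t; rewrite lee_fin.
apply: eq_integral => t _; congr (g _)%:E.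
rewrite -mulmxBr -LM /qform !mulmxA -mulmxA -trmx_mul mxE.
by apply: eq_bigr => i _; rewrite tnth_mktuple mxE expr2.
Qed.

Lemma integral_gaussian_qform n (M : 'M[R]_n) (m : 'cV[R]_n) (s : R) :
  pdmx M -> 0 < s ->
  (\int[lebesgue_tuple n]_t (expR (- (s / 2) * qform M (cvec t - m)))%:E =
   ((Num.sqrt (\det M))^-1 * Num.sqrt (2 * pi / s) ^+ n)%:E)%E.
Proof.
move=> pdM s0; rewrite (@integral_radial _ _ _ (fun x => expR (- (s / 2) * x))) //.
  rewrite EFinM; congr (_ * _)%E.
  rewrite -(integral_prod _ _ _ (integral_gaussian s0)) //.
    by apply: eq_integral => t _; rewrite mulr_sumr expR_sum.
  apply: measurableT_comp => //; apply: measurable_funM => //.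
by apply: measurableT_comp => //; exact: measurable_funM.
Qed.

(** Comparison of the 1-norm with the Euclidean norm: with [S] the sum of the [|x i|],
    expand the sum of the squares of [n |x i| - S]. *)
Lemma sum_abs_le_norm n (x : 'I_n -> R) :
  \sum_i `|x i| <= Num.sqrt n%:R * Num.sqrt (\sum_i x i ^+ 2).
Proof.
case: n x => [|n] x; first by rewrite !big_ord0 sqrtr0 mulr0.
set S := \sum_i `|x i|; set Q := \sum_i _ ^+ 2.
have S0 : 0 <= S by apply: sumr_ge0.
rewrite -sqrtrM ?ler0n // -(ger0_norm S0) -sqrtr_sqr ler_wsqrtr //.
have : 0 <= \sum_i (n.+1%:R * `|x i| - S) ^+ 2.
  by apply: sumr_ge0 => i _; exact: sqr_ge0.
have -> : \sum_i (n.+1%:R * `|x i| - S) ^+ 2 = n.+1%:R * (n.+1%:R * Q - S ^+ 2).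
  under eq_bigr do rewrite sqrrB exprMn real_normK ?num_real //.
  rewrite big_split /= sumrB -mulr_sumr -/Q sumr_const card_ord.
  rewrite -(mulr_natl (S ^+ 2)).
  under eq_bigr do rewrite -mulrA -mulrnAr.
  rewrite -mulr_sumr sumrMnl -mulr_suml -/S.
  by rewrite mulrnAr; ring.
by rewrite pmulr_rge0 ?ltr0Sn // subr_ge0.
Qed.

(** Replacing the Euclidean norm by the smaller 1-norm divided by [sqrt n] makes the
    integrand a product, at the price of a factor [sqrt n] per coordinate.  This
    factor is harmless later, where [a] is large compared with [sqrt n]. *)
Lemma integral_expnorm_le n (M : 'M[R]_n) (m : 'cV[R]_n) (a : R) :
  (0 < n)%N -> pdmx M -> 0 < a ->
  (\int[lebesgue_tuple n]_t (expR (- a * Num.sqrt (qform M (cvec t - m))))%:E <=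
   ((Num.sqrt (\det M))^-1 * (2 * Num.sqrt n%:R / a) ^+ n)%:E)%E.
Proof.
move=> n0 pdM a0.
have mg : measurable_fun setT (fun x : R => expR (- a * Num.sqrt x)).
  apply: measurableT_comp => //; apply: measurable_funM => //.
  by apply: continuous_measurable_fun; exact: sqrt_continuous.
rewrite (@integral_radial _ _ _ (fun x => expR (- a * Num.sqrt x))) //.
rewrite EFinM; apply: lee_wpmul2l.
  by rewrite lee_fin invr_ge0 sqrtr_ge0.
have sn : 0 < Num.sqrt n%:R :> R by rewrite sqrtr_gt0 ltr0n.
(* the exponential rate left for each coordinate *)
pose a' := a / Num.sqrt n%:R.
have a'0 : 0 < a' by rewrite divr_gt0.
pose g (x : R) := expR (- a' * `|x|).
have mgg : measurable_fun setT g.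
  by apply: measurableT_comp => //; apply: measurable_funM.
have := integral_laplace_le a'0; rewrite -/(g _).
set I := (\int[_]_x _)%E => Ile.
have I0 : (0 <= I)%E by apply: integral_ge0 => x _; rewrite lee_fin expR_ge0.
have If : I \is a fin_num by rewrite ge0_fin_numE // (le_lt_trans Ile) ?ltry.
have := @integral_prod R n g (fine I) mgg (fun x => expR_ge0 _).
rewrite fineK // => /(_ erefl) prodI.
apply: (@le_trans _ _ (fine I ^+ n)%:E).
  rewrite -prodI; apply: ge0_le_integral => //.
  - apply/measurable_EFinP; apply: (measurableT_comp mg).
    apply: measurable_sum => i; apply: measurable_funX.
    exact: measurable_tnth.
  - exact: measurable_prod_tnth.
  - move=> t _; rewrite lee_fin /g -expR_sum ler_expR -mulr_sumr !mulNr lerN2.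
    rewrite /a' -mulrA ler_pM2l // ler_pdivrMl // .
    exact: sum_abs_le_norm.
have ca : 2 * Num.sqrt n%:R / a = 2 / a' by rewrite /a' invf_div mulrA.
rewrite lee_fin ca; apply: lerXn2r.
- by rewrite nnegrE fine_ge0.
- by rewrite nnegrE ltW // divr_gt0.
- by rewrite -lee_fin fineK.
Qed.

End gaussian_integrals.

(** * Positive definite matrices relative to one another *)

Section matrices.
Context {R : realType}.

Lemma pdmx_unit n (A : 'M[R]_n) : pdmx A -> A \in unitmx.
Proof. by move=> /pdmx_det_gt0 dA; rewrite unitmxE unitfE gt_eqF. Qed.

Lemma qform_trmul n m (P : 'M[R]_(n, m)) (A : 'M[R]_n) v :
  qform (P^T *m A *m P) v = qform A (P *m v).
Proof. by rewrite /qform trmx_mul !mulmxA. Qed.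

Lemma qform_ge0 n (A : 'M[R]_n) v : pdmx A -> 0 <= qform A v.
Proof.
move=> [_ A0]; have [->|/A0/ltW //] := eqVneq v 0.
by rewrite /qform mulmx0 mxE.
Qed.

Lemma qformZ n (A : 'M[R]_n) (t : R) v : qform A (t *: v) = t ^+ 2 * qform A v.
Proof.
by rewrite /qform [(t *: v)^T]linearZ /= -scalemxAr -!scalemxAl scalerA mxE -expr2.
Qed.

Lemma qformBl n (A B : 'M[R]_n) v : qform (A - B) v = qform A v - qform B v.
Proof. by rewrite /qform mulmxBr mulmxBl !mxE. Qed.

Lemma trmx_sub_sym n (A B : 'M[R]_n) : A^T = A -> B^T = B -> (A - B)^T = A - B.
Proof. by move=> symA symB; rewrite linearB /= symA symB. Qed.

Lemma qform_scale n (A : 'M[R]_n) (t : R) v : qform (t *: A) v = t * qform A v.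
Proof. by rewrite /qform -scalemxAr -scalemxAl mxE. Qed.

Lemma pdmxZ n (A : 'M[R]_n) (t : R) : 0 < t -> pdmx A -> pdmx (t *: A).
Proof.
move=> t0 [symA A0]; split=> [|v v0]; first by rewrite linearZ /= symA.
by rewrite qform_scale mulr_gt0 // A0.
Qed.

Lemma pdmx_trmul n m (P : 'M[R]_(n, m)) (A : 'M[R]_n) :
  (forall v : 'cV_m, P *m v = 0 -> v = 0) -> pdmx A -> pdmx (P^T *m A *m P).
Proof.
move=> P0 [symA A0]; split=> [|v v0]; first by rewrite !trmx_mul trmxK symA mulmxA.
by rewrite qform_trmul A0 //; apply: contra v0 => /eqP/P0 ->.
Qed.

Lemma pdmx_psd n (A : 'M[R]_n) : pdmx A -> psdmx A.
Proof. by move=> pA; split; [case: pA|move=> v; exact: qform_ge0]. Qed.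

(** [A = S S] with [S] symmetric, so the form vanishes only where [S v = 0]. *)
Lemma psdmx_unit_pd n (A : 'M[R]_n) : psdmx A -> A \in unitmx -> pdmx A.
Proof.
move=> psdA uA; have [[symS _] SS] := psdmx_sqrt psdA.
split; first by case: psdA.
move=> v v0.
have -> : qform A v = qform 1%:M (sqrtmx A *m v).
  by rewrite -qform_trmul symS mulmx1 SS.
rewrite qform1_gt0 //; apply: contra v0 => /eqP Sv0.
by rewrite -(mulKmx uA v) -{2}SS -mulmxA Sv0 !mulmx0.
Qed.

Lemma pdmx_sqrt n (A : 'M[R]_n) : pdmx A ->
  [/\ (sqrtmx A)^T = sqrtmx A, sqrtmx A *m sqrtmx A = A &
      sqrtmx A \in unitmx].
Proof.
move=> pA; have [[symS _] SS] := psdmx_sqrt (pdmx_psd pA).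
split=> //; have := pdmx_unit pA.
by rewrite -{1}SS unitmx_mul andbb.
Qed.

Lemma norm2_sqr n (v : 'cV[R]_n) : norm2 v ^+ 2 = qform 1%:M v.
Proof. by rewrite /norm2 -qform1 sqr_sqrtr // qform1 sumr_ge0 // => i _; rewrite sqr_ge0. Qed.

Lemma qform_sqrt n (B : 'M[R]_n) v : pdmx B ->
  qform 1%:M (sqrtmx B *m v) = qform B v.
Proof.
move=> /pdmx_sqrt[symS SS _].
by rewrite -qform_trmul symS mulmx1 SS.
Qed.

(** Congruence by the inverse square root of [B] turns comparisons with [B] into
    comparisons with the identity, for which eigenvalues are informative. *)
Lemma qform_isqrt n (A B : 'M[R]_n) v : pdmx B ->
  qform (isqrtmx B *m A *m isqrtmx B) (sqrtmx B *m v) = qform A v.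
Proof.
move=> /pdmx_sqrt[symS SS uS].
have symI : (isqrtmx B)^T = isqrtmx B by rewrite /isqrtmx trmx_inv symS.
by rewrite -{1}symI qform_trmul /isqrtmx mulKmx.
Qed.

Lemma isqrt_sym n (A B : 'M[R]_n) : pdmx B -> A^T = A ->
  (isqrtmx B *m A *m isqrtmx B)^T = isqrtmx B *m A *m isqrtmx B.
Proof.
move=> /pdmx_sqrt[symS SS uS] symA.
by rewrite !trmx_mul /isqrtmx trmx_inv symS symA mulmxA.
Qed.

(** This is how a bound on the least eigenvalue of [V_n(beta)] is used: it says that
    [A_n(beta)] dominates a multiple of [B_n]. *)
Lemma lambda_min_relative n (A B : 'M[R]_n) v : pdmx B -> A^T = A ->
  lambda_min (isqrtmx B *m A *m isqrtmx B) * qform B v <= qform A v.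
Proof.
move=> pB symA; rewrite -(qform_isqrt A v pB) -(qform_sqrt v pB).
exact/lambda_minP/isqrt_sym.
Qed.

Lemma lambda_max_relative n (A B : 'M[R]_n) v : pdmx B -> A^T = A ->
  qform A v <= lambda_max (isqrtmx B *m A *m isqrtmx B) * qform B v.
Proof.
move=> pB symA; rewrite -(qform_isqrt A v pB) -(qform_sqrt v pB).
exact/lambda_maxP/isqrt_sym.
Qed.

(** The form of the identity is nonnegative at [|v|^2 u - (u . v) v]. *)
Lemma cauchy_schwarz n (u v : 'cV[R]_n) :
  (u^T *m v) 0 0 ^+ 2 <= qform 1%:M u * qform 1%:M v.
Proof.
set c := (u^T *m v) 0 0.
have cE : v^T *m u = u^T *m v.
  rewrite [u^T *m v]mx11_scalar -tr_scalar_mx -mx11_scalar trmx_mul trmxK //.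
have [v0|v0] := eqVneq v 0.
  have -> : qform 1%:M v = 0 by rewrite v0 /qform mulmx0 mxE.
  by rewrite mulr0 /c v0 mulmx0 mxE expr0n.
have qv := qform1_gt0 v0.
have : 0 <= qform 1%:M (qform 1%:M v *: u - c *: v).
  by rewrite qform1 sumr_ge0 // => i _; exact: sqr_ge0.
suff -> : qform 1%:M (qform 1%:M v *: u - c *: v) =
    qform 1%:M v * (qform 1%:M u * qform 1%:M v - c ^+ 2).
  by rewrite pmulr_rge0 // subr_ge0.
rewrite {1}/qform !mulmx1 [(_ - _)^T]linearB [X in X - _]linearZ [X in _ - X]linearZ /=.
rewrite mulmxBl !mulmxBr.
rewrite -!scalemxAl -!scalemxAr cE !mxE -/c.
have E w : (w^T *m w) 0 0 = qform 1%:M w :> R by rewrite /qform mulmx1.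
have := E _ u; have := E _ v; rewrite !mxE => -> ->.
have -> : \sum_j u^T 0 j * v j 0 = c by rewrite /c mxE.
by ring.
Qed.

End matrices.

(** * Second-order estimates on the line *)

Section second_order.
Context {R : realType}.
Implicit Types g : R -> R.

Lemma is_derive_mvt g g1 (a c : R) : (forall t : R, is_derive t 1 g (g1 t)) ->
  a <= c -> exists2 x, a <= x <= c & g c - g a = g1 x * (c - a).
Proof.
move=> dg ac; have cg : {within `[a, c], continuous g}.
  apply: continuous_subspaceT => x.
  by apply/differentiable_continuous/derivable1_diffP; have [] := dg x.
have [x xac E] := MVT_segment ac (fun x _ => dg x) cg.
by exists x => //; move: xac; rewrite in_itv.
Qed.

Lemma max_derive0 g g1 : (forall t : R, is_derive t 1 g (g1 t)) ->
  (forall t : R, g t <= g 0) -> g1 0 = 0.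
Proof.
move=> dg g0; have le11 : (-1 : R) <= 1 by lra.
have dg' t : t \in `]-1, 1[%R -> derivable g t 1 by move=> _; have [] := dg t.
have in0 : (0 : R) \in `]-1, 1[%R by rewrite in_itv /= ltrN10 ltr01.
have [_ E] := derive1_at_max le11 dg' in0 (fun t _ => g0 t).
by have [_ E0] := dg 0; rewrite -E0 E.
Qed.

(** The function [g t + m t^2 / 2] has a nonpositive derivative on [[0, 1]], by two
    applications of the mean value theorem. *)
Lemma taylor2_le g g1 g2 (m : R) :
  (forall t : R, is_derive t 1 g (g1 t)) ->
  (forall t : R, is_derive t 1 g1 (g2 t)) -> g1 0 = 0 ->
  (forall t, 0 <= t <= 1 -> g2 t <= - m) -> g 1 - g 0 <= - (m / 2).
Proof.
move=> dg dg1 g10 g2m.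
(* [k] is nonincreasing on [[0, 1]] *)
pose k t := g t + (m / 2) * t ^+ 2.
have dk (t : R) : is_derive t 1 k (g1 t + m * t).
  have -> : k = g + (m / 2) *: ((id : R -> R) * (id : R -> R)).
    by apply/funext => x; rewrite /k expr2.
  have d2 := is_deriveM (is_derive_id t (1 : R)) (is_derive_id t (1 : R)).
  have d3 := is_deriveD (dg t) (is_deriveZ (m / 2) d2).
  apply: (is_derive_eq d3).
  by rewrite /GRing.scale /=; field.
have [x /andP[x0 x1] E] := is_derive_mvt dk (ler01 : 0 <= 1 :> R).
have [z /andP[z0 zx] E1] := is_derive_mvt dg1 x0.
have : k 1 - k 0 <= 0.
  rewrite E subr0 mulr1.
  have := E1; rewrite g10 !subr0 => ->.
  rewrite -mulrDl mulr_le0_ge0 // -lerBrDr sub0r g2m // z0 /=.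
  exact: le_trans x1.
rewrite /k expr0n expr1n mulr0 addr0 mulr1; lra.
Qed.

Lemma taylor2_ge g g1 g2 (m : R) :
  (forall t : R, is_derive t 1 g (g1 t)) ->
  (forall t : R, is_derive t 1 g1 (g2 t)) -> g1 0 = 0 ->
  (forall t, 0 <= t <= 1 -> - m <= g2 t) -> - (m / 2) <= g 1 - g 0.
Proof.
move=> dg dg1 g10 g2m.
suff : - g 1 - - g 0 <= - (- m / 2) by lra.
apply: (@taylor2_le (- g) (- g1) (- g2)).
- by rewrite /GRing.opp /= g10 oppr0.
- by move=> t t01; rewrite opprK lerNl; exact: g2m.
Qed.

(** The slope of [g] on [[0, s]] is at least its slope on [[s, 1]]. *)
Lemma concave_chord g g1 g2 (s : R) :
  (forall t : R, is_derive t 1 g (g1 t)) -> (forall t : R, is_derive t 1 g1 (g2 t)) ->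
  (forall t, g2 t <= 0) -> 0 <= s <= 1 -> (1 - s) * g 0 + s * g 1 <= g s.
Proof.
move=> dg dg1 g2m /andP[s0 s1].
have [x /andP[x0 xs] E] := is_derive_mvt dg s0.
have [z /andP[sz z1] E1] := is_derive_mvt dg s1.
have [c _ E2] := is_derive_mvt dg1 (le_trans xs sz).
have : g1 z <= g1 x.
  by rewrite -subr_le0 E2 mulr_le0_ge0 // subr_ge0 (le_trans xs).
move=> g1zx; have gs : g s = g 0 + g1 x * s.
  by apply/eqP; rewrite addrC -subr_eq E subr0.
have g1E : g 1 = g 0 + g1 x * s + g1 z * (1 - s).
  by rewrite -gs; apply/eqP; rewrite addrC -subr_eq E1.
rewrite -subr_ge0 g1E gs (_ : _ - _ = (1 - s) * s * (g1 x - g1 z)); last by ring.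
by rewrite !mulr_ge0 // subr_ge0.
Qed.

End second_order.

(** * The quasi-log-likelihood along lines *)

Section likelihood.
Context {R : realType} (b : R -> R).
Hypothesis bC2 : cumulant_function b.

Lemma is_derive_affine_comp (f f1 : R -> R) (a c t : R) :
  (forall x : R, is_derive x 1 f (f1 x)) ->
  is_derive t 1 (fun t => f (a + t * c)) (f1 (a + t * c) * c).
Proof.
move=> df; have -> : (fun t => f (a + t * c)) = f \o (cst a + c *: (id : R -> R)).
  by apply/funext => x; congr (f (_ + _)); exact: mulrC.
have d1 := is_deriveD (is_derive_cst a t (1 : R)) (is_deriveZ c (is_derive_id t (1 : R))).
have d2 := is_derive1_comp (df ((cst a + c *: (id : R -> R)) t)) d1.
apply: (is_derive_eq d2).
by rewrite add0r /GRing.scale /= mulr1; congr (f1 (_ + _) * _); exact: mulrC.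
Qed.

Lemma is_derive_sum_fun n (f : 'I_n -> R -> R) (df : 'I_n -> R) (t : R) :
  (forall i, is_derive t 1 (f i) (df i)) ->
  is_derive t 1 (fun t => \sum_i f i t) (\sum_i df i).
Proof.
move=> d; have -> : (fun t => \sum_i f i t) = \sum_i f i.
  by apply/funext => x; rewrite fct_sumE.
exact: is_derive_sum.
Qed.

Lemma is_derive_cumulant (x : R) : is_derive x 1 b (derive1 b x).
Proof. by case: bC2 => /(_ x)/derivableP + _ _ _; rewrite -derive1E. Qed.

Lemma is_derive_mean (x : R) : is_derive x 1 (derive1 b) (derive1n 2 b x).
Proof. by case: bC2 => _ /(_ x)/derivableP + _ _; rewrite -derive1E. Qed.

Lemma derive2_gt0 x : 0 < derive1n 2 b x.
Proof. by case: bC2 => _ _ _ [k k0 /(_ x)]; exact: lt_le_trans. Qed.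

Context {n d : nat} (D : glm_data R n d).
Implicit Types (y : 'cV[R]_n) (beta h v : 'cV[R]_d).
Local Notation qll := (qll b D).
Local Notation Amx := (Amx b D).

(** The derivative in [t] of the quasi-log-likelihood at [beta + t h]. *)
Definition score_line y beta h (t : R) : R :=
  (y^T *m linpred D h) 0 0 -
  \sum_i derive1 b (linpred D (beta + t *: h) i 0) * linpred D h i 0.

Lemma linpred_line beta h t i :
  linpred D (beta + t *: h) i 0 = linpred D beta i 0 + t * linpred D h i 0.
Proof. by rewrite /linpred mulmxDr -scalemxAr !mxE. Qed.

Lemma qll_line y beta h t :
  qll y (beta + t *: h) = (y^T *m linpred D beta) 0 0 +
    t * (y^T *m linpred D h) 0 0 -
    \sum_i b (linpred D beta i 0 + t * linpred D h i 0).
Proof.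
rewrite /Defs.qll; under eq_bigr do rewrite linpred_line.
by rewrite /linpred mulmxDr -scalemxAr mulmxDr -scalemxAr !mxE.
Qed.

Lemma qform_Sigma (theta v : 'cV[R]_n) :
  qform (Sigma b theta) v = \sum_i derive1n 2 b (theta i 0) * v i 0 ^+ 2.
Proof.
rewrite /qform /Sigma mul_mx_diag mxE.
by apply: eq_bigr => i _; rewrite !mxE mulrAC mulrC.
Qed.

Lemma qform_Amx beta v :
  qform (Amx beta) v =
  \sum_i derive1n 2 b (linpred D beta i 0) * linpred D v i 0 ^+ 2.
Proof. by rewrite /Defs.Amx qform_trmul qform_Sigma. Qed.

Lemma is_derive_qll y beta h (t : R) :
  is_derive t 1 (fun t => qll y (beta + t *: h)) (score_line y beta h t).
Proof.
rewrite (_ : (fun t => _) = (fun t => (y^T *m linpred D beta) 0 0 +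
    t * (y^T *m linpred D h) 0 0)
  - (fun t => \sum_i b (linpred D beta i 0 + t * linpred D h i 0))); last first.
  by apply/funext => x; rewrite qll_line.
have d1 := is_derive_affine_comp ((y^T *m linpred D beta) 0 0)
  ((y^T *m linpred D h) 0 0) t (fun x => is_derive_id x (1 : R)).
have d2 : is_derive t 1 (fun t => \sum_i b (linpred D beta i 0 + t * linpred D h i 0))
    (\sum_i derive1 b (linpred D beta i 0 + t * linpred D h i 0) * linpred D h i 0).
  apply: is_derive_sum_fun => i.
  exact: (is_derive_affine_comp _ _ _ is_derive_cumulant).
apply: (is_derive_eq (is_deriveB d1 d2)).
rewrite mul1r /score_line; congr (_ - _); apply: eq_bigr => i _.
by rewrite linpred_line.
Qed.

(** The observation has disappeared: this is where the canonical link matters. *)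
Lemma is_derive_score y beta h (t : R) :
  is_derive t 1 (score_line y beta h) (- qform (Amx (beta + t *: h)) h).
Proof.
rewrite (_ : score_line _ _ _ = cst ((y^T *m linpred D h) 0 0) -
  (fun t => \sum_i linpred D h i 0 *: derive1 b (linpred D beta i 0 + t * linpred D h i 0))); last first.
  apply/funext => x; rewrite /score_line; congr (_ - _).
  by apply: eq_bigr => i _; rewrite linpred_line mulrC.
have d2 : is_derive t 1 (fun t => \sum_i linpred D h i 0 *:
      derive1 b (linpred D beta i 0 + t * linpred D h i 0))
    (\sum_i linpred D h i 0 *: (derive1n 2 b (linpred D beta i 0 + t * linpred D h i 0) * linpred D h i 0)).
  apply: is_derive_sum_fun => i; apply: is_deriveZ.
  exact: (is_derive_affine_comp _ _ _ is_derive_mean).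
apply: (is_derive_eq (is_deriveB (is_derive_cst _ _ _) d2)).
rewrite sub0r qform_Amx; congr (- _); apply: eq_bigr => i _.
by rewrite linpred_line /GRing.scale /= mulrCA -expr2.
Qed.

(** Taylor's formula along the segment from a maximizer, where the first-order term
    vanishes. *)
Lemma qll_le_quadratic y beta h m : (forall v, qll y v <= qll y beta) ->
  (forall t, 0 <= t <= 1 -> m <= qform (Amx (beta + t *: h)) h) ->
  qll y (beta + h) - qll y beta <= - (m / 2).
Proof.
move=> bmax mA.
have s0 : score_line y beta h 0 = 0.
  apply: (@max_derive0 _ _ _ (is_derive_qll y beta h)) => t.
  by rewrite scale0r addr0.
have := taylor2_le (is_derive_qll y beta h) (is_derive_score y beta h) s0.
rewrite scale1r scale0r addr0; apply => t t01.
by rewrite lerN2 mA.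
Qed.

Lemma qll_ge_quadratic y beta h m : (forall v, qll y v <= qll y beta) ->
  (forall t, 0 <= t <= 1 -> qform (Amx (beta + t *: h)) h <= m) ->
  - (m / 2) <= qll y (beta + h) - qll y beta.
Proof.
move=> bmax mA.
have s0 : score_line y beta h 0 = 0.
  apply: (@max_derive0 _ _ _ (is_derive_qll y beta h)) => t.
  by rewrite scale0r addr0.
have := taylor2_ge (is_derive_qll y beta h) (is_derive_score y beta h) s0.
rewrite scale1r scale0r addr0; apply => t t01.
by rewrite lerN2 mA.
Qed.

Lemma qll_concave y beta h (s : R) : 0 <= s <= 1 ->
  s * (qll y (beta + h) - qll y beta) <= qll y (beta + s *: h) - qll y beta.
Proof.
move=> s01.
have := concave_chord (is_derive_qll y beta h) (is_derive_score y beta h) _ s01.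
rewrite scale1r scale0r addr0 => hc.
have : (1 - s) * qll y beta + s * qll y (beta + h) <= qll y (beta + s *: h).
  apply: hc => t; rewrite oppr_le0 qform_Amx sumr_ge0 // => i _.
  by rewrite mulr_ge0 ?sqr_ge0 // ltW // derive2_gt0.
lra.
Qed.

End likelihood.

(** * Laplace bounds for the likelihood ratio integral *)

Section laplace.
Context {R : realType} (b : R -> R).
Hypothesis bC2 : cumulant_function b.
Context {n d : nat} (D : glm_data R n d).
Local Notation RR := (measurableTypeR R).

Lemma measurable_cumulant : measurable_fun setT b.
Proof.
apply: continuous_measurable_fun => x.
apply/differentiable_continuous/derivable1_diffP.
by case: bC2 => /(_ x).
Qed.

Lemma measurable_mul_cvec m (C : 'M[R]_(m, d)) i :
  measurable_fun setT (fun t : d.-tuple RR => (C *m cvec t) i 0).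
Proof.
rewrite (_ : (fun _ => _) = fun t => \sum_j C i j * tnth t j); last first.
  by apply/funext => t; rewrite mxE; apply: eq_bigr => j _; rewrite mxE.
apply: measurable_sum => j; apply: measurable_funM => //.
exact: measurable_tnth.
Qed.

Lemma measurable_qll_cvec y (C : 'M[R]_d) :
  measurable_fun setT (fun t : d.-tuple RR => qll b D y (C *m cvec t)).
Proof.
rewrite /qll; apply: measurable_funB.
  rewrite (_ : (fun _ => _) = fun t : d.-tuple RR =>
      ((y^T *m X D *m C) *m cvec t) 0 0); first exact: measurable_mul_cvec.
  by apply/funext => t; rewrite /linpred !mulmxA.
apply: measurable_sum => i; apply: (measurableT_comp measurable_cumulant).
rewrite /linpred; under eq_fun do rewrite mulmxA.
exact: measurable_mul_cvec.
Qed.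

Context (y : 'cV[R]_n) (bh : 'cV[R]_d) (A B : 'M[R]_d) (kappa r2 eps : R).
Hypotheses (bmax : forall v, qll b D y v <= qll b D y bh)
  (pA : pdmx A) (pB : pdmx B) (kappa_gt0 : 0 < kappa) (r2_gt0 : 0 < r2)
  (eps01 : 0 <= eps <= 2^-1).
Hypothesis kappaP : forall v, kappa * qform B v <= qform A v.
Hypothesis curvP : forall beta, qform B (beta - bh) <= r2 -> forall v,
  (1 - eps) * qform A v <= qform (Amx b D beta) v <= (1 + eps) * qform A v.

Let T := Num.sqrt (kappa * r2).
Let T_gt0 : 0 < T. Proof. by rewrite sqrtr_gt0 mulr_gt0. Qed.
Let T_sqr : T ^+ 2 = kappa * r2.
Proof. by rewrite sqr_sqrtr // ltW // mulr_gt0. Qed.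

Lemma segment_in_ball h (t : R) : qform B h <= r2 -> 0 <= t <= 1 ->
  qform B ((bh + t *: h) - bh) <= r2.
Proof.
move=> hr /andP[t0 t1]; rewrite addrAC subrr add0r qformZ.
apply: le_trans hr; rewrite ler_piMl ?qform_ge0 // expr_le1 //.
Qed.

(** On the ball around the maximizer the curvature of the log-likelihood is that of
    [A] up to a relative error [eps]. *)
Lemma qll_ball_le h : qform B h <= r2 ->
  qll b D y (bh + h) - qll b D y bh <= - ((1 - eps) / 2 * qform A h).
Proof.
move=> hr; rewrite -mulrAC; apply: qll_le_quadratic => // t t01.
by have /(_ h)/andP[] := curvP (segment_in_ball hr t01).
Qed.

Lemma qll_ball_ge h : qform B h <= r2 ->
  - ((1 + eps) / 2 * qform A h) <= qll b D y (bh + h) - qll b D y bh.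
Proof.
move=> hr; rewrite -mulrAC; apply: qll_ge_quadratic => // t t01.
by have /(_ h)/andP[] := curvP (segment_in_ball hr t01).
Qed.

(** Shrink [h] to [s h] on the sphere of squared radius [r2].  By concavity the drop
    at [h] is at least [1 / s] times the drop at [s h], which gives a drop of at
    least [s Q / 4] with [Q = qform A h].  Since [kappa B <= A], one has
    [s sqrt Q >= T] as well as [sqrt Q >= T], so the drop is at least
    [T sqrt Q / 4].  Half of it is kept as a decay rate, the other half is bounded
    by the constant that makes the outside negligible. *)
Lemma qll_outside_le h : r2 < qform B h ->
  qll b D y (bh + h) - qll b D y bh <=
  - (T ^+ 2 / 8) - T / 8 * Num.sqrt (qform A h).
Proof.
move=> hr; have qB : 0 < qform B h by exact: lt_trans hr.
(* [s *: h] is on the sphere of squared radius [r2] *)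
pose s := Num.sqrt (r2 / qform B h); pose q := Num.sqrt (qform A h).
have s0 : 0 < s by rewrite sqrtr_gt0 divr_gt0.
have s2 : s ^+ 2 = r2 / qform B h by rewrite sqr_sqrtr // ltW // divr_gt0.
have s1 : s <= 1.
  by rewrite -[leRHS]sqrtr1 ler_wsqrtr // ler_pdivrMr // mul1r ltW.
have q0 : 0 <= q by exact: sqrtr_ge0.
have q2 : q ^+ 2 = qform A h by rewrite sqr_sqrtr // qform_ge0.
have sb : qform B (s *: h) <= r2.
  by rewrite qformZ s2 divfK ?gt_eqF.
have h2 := qll_ball_le sb; rewrite qformZ -q2 in h2.
have s01 : 0 <= s <= 1 by rewrite ltW.
have h1 := qll_concave bC2 D y bh h s01.
move: h1 h2; set l := qll b D y (bh + h) - _; set l' := qll b D y (bh + s *: h) - _; rewrite -/q.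
have Tsq : T <= s * q.
  have sq0 : 0 <= s * q by rewrite mulr_ge0 // ltW.
  rewrite -(ger0_norm sq0) -sqrtr_sqr ler_wsqrtr // exprMn s2 q2.
  rewrite mulrAC ler_pdivlMr // [kappa * r2]mulrC -mulrA ler_pM2l //.
move=> h1 h2.
have h3 : s * l <= s * (- ((1 - eps) / 2 * (s * q * q))).
  by apply: le_trans h1 (le_trans h2 _); rewrite le_eqVlt; apply/orP; left; apply/eqP; ring.
rewrite ler_pM2l // in h3.
apply: le_trans h3 _.
have Tq : T <= q by apply: le_trans Tsq _; rewrite ler_piMl.
have : T * q <= s * q * q by rewrite ler_wpM2r.
have : T * T <= T * q by rewrite ler_pM2l.
have : 4^-1 * (s * q * q) <= (1 - eps) / 2 * (s * q * q).
  by rewrite ler_wpM2r //; [rewrite !mulr_ge0 // ltW|case/andP: eps01 => *; lra].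
rewrite expr2; lra.
Qed.

(** Adding the bound inside the ball and the bound outside avoids splitting the domain
    of integration. *)
Lemma exp_qll_le h : expR (qll b D y (bh + h) - qll b D y bh) <=
  expR (- ((1 - eps) / 2) * qform A h) +
  expR (- (T ^+ 2 / 8)) * expR (- (T / 8) * Num.sqrt (qform A h)).
Proof.
have [hr|hr] := leP (qform B h) r2.
  rewrite -[leLHS]addr0 lerD ?mulr_ge0 ?expR_ge0 //.
  by rewrite ler_expR mulNr qll_ball_le.
rewrite -[leLHS]add0r lerD ?expR_ge0 // -expRD ler_expR mulNr.
exact: qll_outside_le.
Qed.

(** Valid everywhere, for the same reason: outside the ball [A] is at least [T^2], so
    the left-hand side is dominated by the last term.  The weight [p] stands for
    the prior density, which is bounded below on the ball only. *)
Lemma exp_qll_ge h (p c : R) : 0 <= c -> 0 <= p -> (qform B h <= r2 -> c <= p) ->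
  c * expR (- ((1 + eps) / 2) * qform A h) <=
  expR (qll b D y (bh + h) - qll b D y bh) * p +
  c * expR (- (T ^+ 2 / 4)) * expR (- (2^-1 / 2) * qform A h).
Proof.
move=> c0 p0 cp; have [hr|hr] := leP (qform B h) r2.
  rewrite -[leLHS]addr0 lerD ?mulr_ge0 ?expR_ge0 //.
  rewrite mulrC ler_pM ?expR_ge0 ?cp // ler_expR mulNr.
  exact: qll_ball_ge.
rewrite -[leLHS]add0r lerD ?mulr_ge0 ?expR_ge0 // -mulrA -expRD.
rewrite ler_wpM2l // ler_expR T_sqr.
have := kappaP h; have : kappa * r2 <= kappa * qform B h by rewrite ler_pM2l // ltW.
have : eps * qform A h >= 0 by case/andP: eps01 => *; rewrite mulr_ge0 // qform_ge0.
lra.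
Qed.

Lemma sqrt_gaussian (s : R) : 0 < s ->
  Num.sqrt (2 * pi / s) = Num.sqrt (2 * pi) * Num.sqrt s^-1 :> R.
Proof. by move=> s0; rewrite sqrtrM // mulr_ge0 // pi_ge0. Qed.

Section integral.
Variables (C : 'M[R]_d) (p : 'cV[R]_d -> R) (c2 c3 : R).
Hypotheses (d_gt0 : (0 < d)%N) (uC : C \in unitmx)
  (mp : measurable_fun setT (fun t : d.-tuple RR => p (cvec t)))
  (p_ge0 : forall u, 0 <= p u) (p_le : forall u, p u <= c3) (c2_ge0 : 0 <= c2)
  (p_ge : forall u, qform B (C *m u - bh) <= r2 -> c2 <= p u).

Let M := C^T *m A *m C.
Let uh := invmx C *m bh.

Let pM : pdmx M.
Proof.
apply: pdmx_trmul => // v Cv0.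
by rewrite -(mulKmx uC v) Cv0 mulmx0.
Qed.

Let offset u : C *m u = bh + C *m (u - uh).
Proof. by rewrite mulmxBr mulKVmx // addrC subrK. Qed.

Let qformM u : qform A (C *m (u - uh)) = qform M (u - uh).
Proof. by rewrite qform_trmul. Qed.

Let c3_ge0 : 0 <= c3. Proof. exact: le_trans (p_ge0 0) (p_le 0). Qed.

(** The marginal likelihood divided by the maximal likelihood, up to the prior
    probability of the model; [C] is the change of variables from [h(beta)] to
    [beta]. *)
Definition likelihood_ratio_integral : \bar R :=
  (\int[lebesgue_tuple d]_t
    (expR (qll b D y (C *m cvec t) - qll b D y bh) * p (cvec t))%:E)%E.
Let J := likelihood_ratio_integral.
Let G := (Num.sqrt (\det M))^-1 * Num.sqrt (2 * pi) ^+ d.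

Let mJ : measurable_fun setT (fun t : d.-tuple RR =>
  (expR (qll b D y (C *m cvec t) - qll b D y bh) * p (cvec t))%:E).
Proof.
apply/measurable_EFinP/measurable_funM => //.
apply: measurableT_comp => //; apply: measurable_funB => //.
exact: measurable_qll_cvec.
Qed.

Let mqf : measurable_fun setT (fun t : d.-tuple RR => qform M (cvec t - uh)).
Proof.
have [L [LM _ _]] := cholesky_integral pM.
rewrite (_ : (fun _ => _) = fun t : d.-tuple RR =>
    \sum_i ((L *m cvec t) i 0 - (L *m uh) i 0) ^+ 2); last first.
  apply/funext => t; rewrite -LM -[L^T]mulmx1 qform_trmul qform1.
  by apply: eq_bigr => i _; rewrite mulmxBr !mxE.
apply: measurable_sum => i; apply: measurable_funX; apply: measurable_funB => //.
exact: measurable_mul_cvec.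
Qed.

Let mgauss (s : R) :
  measurable_fun setT (fun t : d.-tuple RR => (expR (- s * qform M (cvec t - uh)))%:E).
Proof.
apply/measurable_EFinP; apply: measurableT_comp => //.
exact: measurable_funM.
Qed.

Let mexpn (s : R) :
  measurable_fun setT
    (fun t : d.-tuple RR => (expR (- s * Num.sqrt (qform M (cvec t - uh))))%:E).
Proof.
apply/measurable_EFinP; apply: measurableT_comp => //.
apply: measurable_funM => //; apply: (measurableT_comp _ mqf).
by apply: continuous_measurable_fun; exact: sqrt_continuous.
Qed.

Lemma laplace_upper : (J <= (c3 * (Num.sqrt (1 - eps)^-1 ^+ d +
   expR (- (T ^+ 2 / 8)) * (16 * Num.sqrt d%:R / T / Num.sqrt (2 * pi)) ^+ d) * G)%:E)%E.
Proof.
have eps1 : 0 < 1 - eps by case/andP: eps01 => *; lra.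
pose e1 u := expR (- ((1 - eps) / 2) * qform M (u - uh)).
pose e2 u := expR (- (T / 8) * Num.sqrt (qform M (u - uh))).
pose K := expR (- (T ^+ 2 / 8)).
have le_e t : ((expR (qll b D y (C *m cvec t) - qll b D y bh) * p (cvec t))%:E <=
    c3%:E * ((e1 (cvec t))%:E + K%:E * (e2 (cvec t))%:E))%E.
  have -> : (c3%:E * ((e1 (cvec t))%:E + K%:E * (e2 (cvec t))%:E) =
    (c3 * (e1 (cvec t) + K * e2 (cvec t)))%:E)%E by [].
  rewrite lee_fin mulrC ler_pM ?expR_ge0 //.
  by rewrite offset /e1 /e2 -qformM exp_qll_le.
have me1 : measurable_fun setT (fun t : d.-tuple RR => (e1 (cvec t))%:E).
  exact: mgauss.
have me2 : measurable_fun setT (fun t : d.-tuple RR => K%:E * (e2 (cvec t))%:E)%E.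
  by apply: emeasurable_funM => //; exact: mexpn.
have e1_ge0 t : (0 <= (e1 (cvec t))%:E)%E by rewrite lee_fin expR_ge0.
have e2_ge0 t : (0 <= K%:E * (e2 (cvec t))%:E)%E.
  by rewrite -EFinM lee_fin mulr_ge0 ?expR_ge0.
have me : measurable_fun setT (fun t : d.-tuple RR =>
    (e1 (cvec t))%:E + K%:E * (e2 (cvec t))%:E)%E by exact: emeasurable_funD.
apply: (@le_trans _ _ (\int[lebesgue_tuple d]_t (c3%:E *
    ((e1 (cvec t))%:E + K%:E * (e2 (cvec t))%:E)))%E).
  apply: ge0_le_integral => //.
  - by move=> t _; rewrite lee_fin mulr_ge0 // expR_ge0.
  - exact: emeasurable_funM.
rewrite (ge0_integralZl _ measurableT me) //; last first.
  by move=> t _; rewrite adde_ge0.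
rewrite (ge0_integralD _ measurableT _ me1 _ me2) //.
rewrite (ge0_integralZl _ measurableT (mexpn _)) //; last first.
  by rewrite lee_fin expR_ge0.
rewrite integral_gaussian_qform //.
have T8 : 0 < T / 8 by rewrite divr_gt0.
have := integral_expnorm_le uh d_gt0 pM T8.
set I2 := (\int[_]_x _)%E => I2le.
have s2pi : 0 < Num.sqrt (2 * pi) :> R by rewrite sqrtr_gt0 mulr_gt0 // pi_gt0.
apply: (@le_trans _ _ (c3 * ((Num.sqrt (\det M))^-1 *
    Num.sqrt (2 * pi / (1 - eps)) ^+ d +
    K * ((Num.sqrt (\det M))^-1 * (2 * Num.sqrt d%:R / (T / 8)) ^+ d)))%:E).
  rewrite (EFinM c3); apply: lee_wpmul2l; first by rewrite lee_fin.
  rewrite (EFinD (_ * _)) (EFinM K); apply: leeD2l; apply: lee_wpmul2l => //.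
  by rewrite lee_fin expR_ge0.
rewrite lee_fin /G sqrt_gaussian // exprMn.
have -> : 2 * Num.sqrt d%:R / (T / 8) =
    16 * Num.sqrt d%:R / T / Num.sqrt (2 * pi) * Num.sqrt (2 * pi) :> R.
  by field; rewrite !gt_eqF.
set z := 16 * _ / _ / _; rewrite (exprMn _ z) le_eqVlt; apply/orP; left.
by apply/eqP; rewrite /K; ring.
Qed.

Lemma laplace_lower : ((c2 * (Num.sqrt (1 + eps)^-1 ^+ d -
   expR (- (T ^+ 2 / 4)) * Num.sqrt 2 ^+ d) * G)%:E <= J)%E.
Proof.
have eps1 : 0 < 1 + eps by case/andP: eps01 => *; lra.
pose e1 u := expR (- ((1 + eps) / 2) * qform M (u - uh)).
pose e2 u := expR (- (2^-1 / 2) * qform M (u - uh)).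
pose K := c2 * expR (- (T ^+ 2 / 4)).
pose f u := expR (qll b D y (C *m u) - qll b D y bh) * p u.
have K_ge0 : 0 <= K by rewrite mulr_ge0 ?expR_ge0.
have f_ge0 u : 0 <= f u by rewrite mulr_ge0 ?expR_ge0.
have le_e t : (c2%:E * (e1 (cvec t))%:E <=
    (f (cvec t))%:E + K%:E * (e2 (cvec t))%:E)%E.
  have -> : ((f (cvec t))%:E + K%:E * (e2 (cvec t))%:E =
    (f (cvec t) + K * e2 (cvec t))%:E)%E by [].
  rewrite -EFinM lee_fin /f /e1 /e2 offset -qformM; apply: exp_qll_ge => // hr.
  by apply: p_ge; rewrite offset addrAC subrr add0r.
have me2 : measurable_fun setT (fun t : d.-tuple RR => K%:E * (e2 (cvec t))%:E)%E.
  by apply: emeasurable_funM => //; exact: mgauss.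
have me1 : measurable_fun setT (fun t : d.-tuple RR => c2%:E * (e1 (cvec t))%:E)%E.
  by apply: emeasurable_funM => //; exact: mgauss.
have e2_ge0 t : (0 <= K%:E * (e2 (cvec t))%:E)%E.
  by rewrite -EFinM lee_fin mulr_ge0 ?expR_ge0.
have : (\int[lebesgue_tuple d]_t (c2%:E * (e1 (cvec t))%:E) <=
  \int[lebesgue_tuple d]_t ((f (cvec t))%:E + K%:E * (e2 (cvec t))%:E))%E.
  apply: ge0_le_integral => //.
  - by move=> t _; rewrite -EFinM lee_fin mulr_ge0 ?expR_ge0.
  - exact: emeasurable_funD.
rewrite (ge0_integralZl _ measurableT (mgauss _)) ?lee_fin //.
rewrite (ge0_integralD _ measurableT _ mJ _ me2) //; last first.
  by move=> t _; rewrite lee_fin f_ge0.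
rewrite (ge0_integralZl _ measurableT (mgauss _)) ?lee_fin //.
rewrite !integral_gaussian_qform // -/J -!EFinM -leeBlDr //.
rewrite -EFinB !sqrt_gaussian // invrK !exprMn; apply: le_trans.
rewrite lee_fin /G /K le_eqVlt; apply/orP; left; apply/eqP; ring.
Qed.

End integral.

End laplace.

(** * Moments of the response and the mean quasi-log-likelihood *)

Section integral_comparison.
Context {disp} {T : measurableType disp} {R : realType} (P : probability T R).
Local Notation integrable f := (P.-integrable setT (EFin \o f)).

(** Strict inequality forces [f] to be integrable.  Otherwise either the negative part
    of [f] has infinite integral, and so has that of [f + g], so that both sides
    are [-oo] by the convention on differences; or only the positive part has,
    and the left-hand side is [+oo].  In either case the inequality fails.  It is
    applied with [f] a log-density ratio about which nothing is known in advance. *)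
Lemma integral_lt_add (f g : T -> R) : measurable_fun setT f -> integrable g ->
  (\int[P]_w (f w)%:E < \int[P]_w (f w + g w)%:E)%E -> (0 < \int[P]_w (g w)%:E)%E.
Proof.
move=> mf ig lt_fg; have mfe : measurable_fun setT (EFin \o f).
  exact/measurable_EFinP.
have mg : measurable_fun setT (EFin \o g) by case/integrableP: ig.
have mfg : measurable_fun setT (EFin \o (f \+ g)).
  by apply/measurable_EFinP/measurable_funD => //; exact/measurable_EFinP.
have fin_g : (\int[P]_w `|(g w)%:E| < +oo)%E by case/integrableP: ig.
have [if_|nif] := pselect (integrable f).
  move: lt_fg; under [ltRHS]eq_integral do rewrite EFinD.
  rewrite integralD //= -[ltLHS]adde0 lteD2lE //.
  exact: integrable_fin_num.
(* the positive part of [f] cannot carry all the divergence, as that would make the left-hand side [+oo] *)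
exfalso; have neg_oo : (\int[P]_w ((EFin \o f)^\- w) = +oo)%E.
  have [//|neg_fin] := eqVneq (\int[P]_w ((EFin \o f)^\- w))%E +oo%E.
  have pos_oo : (\int[P]_w ((EFin \o f)^\+ w) = +oo)%E.
    apply/eqP; apply: contra_notT nif => pos_fin.
    apply/integrableP; split => //.
    under eq_integral do rewrite -/((abse \o (EFin \o f)) _) fune_abse.
    rewrite ge0_integralD //; last 2 first.
    - exact: measurable_funepos.
    - exact: measurable_funeneg.
    by apply: lte_add_pinfty; rewrite ltey.
  move: lt_fg; rewrite [ltLHS]integralE pos_oo.
  by case: (\int[P]_w _)%E neg_fin => //= [r _|]; rewrite ?addye // ltNge leey.
have le_neg w : ((EFin \o f)^\- w <= (EFin \o (f \+ g)%R)^\- w + `|(g w)%:E|)%E.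
  rewrite /= !funenegE -!EFinN -!EFin_max /= -EFinD lee_fin.
  set m := Num.max (- (f w + g w)) 0.
  have m1 : - (f w + g w) <= m by rewrite /m le_max lexx.
  have m0 : 0 <= m by rewrite /m le_max lexx orbT.
  have := ler_norm (g w); have := normr_ge0 (g w).
  by rewrite ge_max => *; apply/andP; split; lra.
have : (\int[P]_w ((EFin \o (f \+ g)%R)^\- w) = +oo)%E.
  apply/eqP; apply: contraT => neg_fin.
  have : (+oo <= \int[P]_w ((EFin \o (f \+ g)%R)^\- w + `|(g w)%:E|))%E.
    rewrite -neg_oo; apply: ge0_le_integral => //.
    - exact: measurable_funeneg.
    - apply: emeasurable_funD; first exact: measurable_funeneg.
      exact: measurableT_comp.
  rewrite ge0_integralD //; last 2 first.
  - exact: measurable_funeneg.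
  - exact: measurableT_comp.
  by rewrite leNgt => /negP; case; apply: lte_add_pinfty => //; rewrite ltey.
move=> fgN; move: lt_fg; rewrite [X in (_ < X)%E]integralE fgN.
by case: (\int[P]_w _)%E => //= ; rewrite ?addeNy ?ltNge ?leNye.
Qed.

End integral_comparison.

Section integrable_real.
Context {disp} {T : measurableType disp} {R : realType} (P : probability T R).
Local Notation integrable f := (P.-integrable setT (EFin \o f)).

Lemma integrable_realD (f g : T -> R) : integrable f -> integrable g ->
  integrable (fun w => f w + g w).
Proof. exact: integrableD. Qed.

Lemma integrable_realZ (k : R) (f : T -> R) : integrable f ->
  integrable (fun w => k * f w).
Proof. exact: integrableZl. Qed.

Lemma integrable_real_cst (k : R) : integrable (fun _ : T => k).
Proof. exact: finite_measure_integrable_cst. Qed.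

Lemma integrable_real_le (f g : T -> R) : measurable_fun setT f -> integrable g ->
  (forall w, `|f w| <= g w) -> integrable f.
Proof.
move=> mf ig fg; apply: le_integrable ig => //; first exact/measurable_EFinP.
by move=> w _ /=; rewrite lee_fin (le_trans (fg w)) // ler_norm.
Qed.

Lemma integrable_real_sum I (s : seq I) (f : I -> T -> R) :
  (forall i, integrable (f i)) -> integrable (fun w => \sum_(i <- s) f i w).
Proof.
move=> fi; rewrite (_ : _ \o _ = fun w => (\sum_(i <- s) (f i w)%:E)%E).
  apply: (integrable_sum measurableT) => i _; exact: fi.
by apply/funext => w /=; rewrite sumEFin.
Qed.

Lemma integral_real_sum I (s : seq I) (f : I -> T -> R) (c : I -> R) :
  (forall i, integrable (f i)) -> (forall i, \int[P]_w (f i w)%:E = (c i)%:E)%E ->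
  (\int[P]_w (\sum_(i <- s) f i w)%:E = (\sum_(i <- s) c i)%:E)%E.
Proof.
move=> fi fc; under eq_integral do rewrite -sumEFin.
rewrite (integral_sum measurableT fi) -sumEFin.
by apply: eq_bigr => i _; exact: fc.
Qed.

End integrable_real.

Section moments.
Context {R : realType} (b : R -> R) {n d : nat} (D : glm_data R n d).
Hypothesis bC2 : cumulant_function b.
Hypothesis m2 : forall i, exists K : R,
  ('E_(Pr D)[fun w => (Y D i w ^+ 2)%R] <= K%:E)%E.
Local Notation P := (Pr D).
Local Notation integrable f := (P.-integrable setT (EFin \o f)).

Definition centered (w : Omega D) : 'cV[R]_n := Yvec w - EY D.

Lemma measurable_response i : measurable_fun setT (Y D i).
Proof. exact: measurable_funP. Qed.

Lemma centeredE w i : centered w i 0 = Y D i w - EY D i 0.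
Proof. by rewrite !mxE. Qed.

Lemma measurable_centered i : measurable_fun setT (fun w => centered w i 0).
Proof.
under eq_fun do rewrite centeredE.
by apply: measurable_funB => //; exact: measurable_response.
Qed.

Lemma integrable_response_sqr i : integrable (fun w => Y D i w ^+ 2).
Proof.
have [K] := m2 i; rewrite expectation.unlock => YK.
apply/integrableP; split.
  by apply/measurable_EFinP/measurable_funX; exact: measurable_response.
apply: le_lt_trans (ltry K); apply: le_trans YK.
rewrite le_eqVlt; apply/orP; left; apply/eqP; apply: eq_integral => w _ /=.
by rewrite ger0_norm // sqr_ge0.
Qed.

Lemma integrable_response i : integrable (Y D i).
Proof.
apply: (@integrable_real_le _ _ _ _ _ (fun w => 1 + Y D i w ^+ 2)).
- exact: measurable_response.
- by apply: integrable_realD; [exact: integrable_real_cst|exact: integrable_response_sqr].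
- move=> w; rewrite -real_normK ?num_real //.
  have := sqr_ge0 (`|Y D i w| - 1); have := normr_ge0 (Y D i w).
  by rewrite sqrrB1; nra.
Qed.

Lemma integral_response i : (\int[P]_w (Y D i w)%:E = (EY D i 0)%:E)%E.
Proof.
rewrite mxE expectation.unlock fineK //.
exact: (integrable_fin_num measurableT (integrable_response i)).
Qed.

Lemma integrable_centered2 i j :
  integrable (fun w => centered w i 0 * centered w j 0).
Proof.
have i2 k : integrable (fun w => centered w k 0 ^+ 2).
  apply: (@integrable_real_le _ _ _ _ _
      (fun w => 2 * Y D k w ^+ 2 + 2 * EY D k 0 ^+ 2)).
  - exact/measurable_funX/measurable_centered.
  - apply: integrable_realD; last exact: integrable_real_cst.
    exact/integrable_realZ/integrable_response_sqr.
  - move=> w; rewrite ger0_norm ?sqr_ge0 // centeredE.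
    by have := sqr_ge0 (Y D k w + EY D k 0); nra.
apply: (@integrable_real_le _ _ _ _ _
    (fun w => centered w i 0 ^+ 2 + centered w j 0 ^+ 2)).
- by apply: measurable_funM; exact: measurable_centered.
- exact: integrable_realD.
- move=> w; rewrite normrM -(real_normK (num_real (centered w i 0))).
  rewrite -(real_normK (num_real (centered w j 0))).
  have := sqr_ge0 (`|centered w i 0| - `|centered w j 0|).
  have := normr_ge0 (centered w i 0); have := normr_ge0 (centered w j 0).
  by nra.
Qed.

Lemma integral_centered2 i j :
  (\int[P]_w (centered w i 0 * centered w j 0)%:E = (covY D i j)%:E)%E.
Proof.
rewrite mxE covariance.unlock expectation.unlock fineK.
  apply: eq_integral => w _; rewrite !centeredE !mxE expectation.unlock //.
have := integrable_fin_num measurableT (integrable_centered2 i j).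
congr (_ \is a fin_num); apply: eq_integral => w _.
by rewrite /= !centeredE !mxE expectation.unlock.
Qed.

Lemma integral_qform_centered (K : 'M[R]_n) :
  (\int[P]_w (qform K (centered w))%:E = (\sum_i \sum_j K i j * covY D i j)%:E)%E.
Proof.
under eq_integral do rewrite qformE.
apply: integral_real_sum => i.
  by apply: integrable_real_sum => j; exact/integrable_realZ/integrable_centered2.
apply: integral_real_sum => j; first exact/integrable_realZ/integrable_centered2.
under eq_integral do rewrite EFinM.
rewrite integralZl //; last exact: integrable_centered2.
by rewrite integral_centered2.
Qed.

(** The form of the covariance matrix at [v] is the expectation of the square of
    [v . (Y - EY)]. *)
Lemma covY_psdmx : psdmx (covY D).
Proof.
split; first by apply/matrixP => i j; rewrite !mxE covarianceC.
move=> v; rewrite -/(qform _ _) -lee_fin.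
have -> : qform (covY D) v = \sum_i \sum_j (v *m v^T) i j * covY D i j.
  rewrite qformE; apply: eq_bigr => i _; apply: eq_bigr => j _.
  by rewrite [(v *m _) i j]mxE big_ord1 [v^T _ _]mxE mulrC.
rewrite -integral_qform_centered; apply: integral_ge0 => w _; rewrite lee_fin.
have -> : qform (v *m v^T) (centered w) = qform 1%:M (v^T *m centered w).
  by rewrite -qform_trmul trmxK mulmx1.
by rewrite qform1 sumr_ge0 // => i _; exact: sqr_ge0.
Qed.

Lemma dotE (y u : 'cV[R]_n) : (y^T *m u) 0 0 = \sum_i u i 0 * y i 0.
Proof. by rewrite mxE; apply: eq_bigr => i _; rewrite mxE mulrC. Qed.

Lemma integrable_dot_response (u : 'cV[R]_n) :
  integrable (fun w => ((Yvec w)^T *m u) 0 0).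
Proof.
under eq_fun do rewrite dotE.
apply: integrable_real_sum => i; under eq_fun do rewrite [Yvec _ _ _]mxE.
exact/integrable_realZ/integrable_response.
Qed.

Lemma integral_dot_response (u : 'cV[R]_n) :
  (\int[P]_w (((Yvec w)^T *m u) 0 0)%:E = (((EY D)^T *m u) 0 0)%:E)%E.
Proof.
rewrite dotE; under eq_integral do rewrite dotE.
apply: integral_real_sum => i; under eq_fun do rewrite [Yvec _ _ _]mxE.
  exact/integrable_realZ/integrable_response.
under eq_integral do rewrite EFinM.
by rewrite integralZl // ?integral_response //; exact: integrable_response.
Qed.

Lemma integrable_qll beta : integrable (fun w : Omega D => qll b D (Yvec w) beta).
Proof.
apply: integrable_realD; last exact: integrable_real_cst.
exact: integrable_dot_response.
Qed.

(** The log-likelihood is affine in the observation. *)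
Lemma integral_qll beta :
  (\int[P]_w (qll b D (Yvec w) beta)%:E = (qll b D (EY D) beta)%:E)%E.
Proof.
rewrite /qll; under eq_integral do rewrite EFinB.
rewrite integralB //; last 2 first.
- exact: integrable_dot_response.
- exact: integrable_real_cst.
have P1 : (Pr D [set: Omega D] = 1)%E by exact: probability_setT.
rewrite integral_cst // [X in (_ - _ * X)%E]P1 mule1 EFinB.
by rewrite integral_dot_response.
Qed.

Hypothesis model : glm_setting b D.

(** Almost surely no [Y_i] falls in the zero set of its own density.  This matters
    because [ln] is [0] at [0]. *)
Lemma true_dens_gt0_ae : {ae P, forall w, 0 < true_dens D (Yvec w)}.
Proof.
have [[_ gm gP _] _ _ _] := model.
(* the density integrates to zero over its own zero set *)
pose N i := [set w | dens D i (Y D i w) = 0].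
have mZ i : measurable [set z | dens D i z = 0].
  have [mg _] := gm i; rewrite -[X in measurable X]setTI.
  exact: (mg measurableT [set 0] (measurable_set1 0)).
have PN i : P (N i) = 0%E.
  have -> : N i = Y D i @^-1` [set z | dens D i z = 0] by [].
  by rewrite gP // integral0_eq // => z /= ->.
have mN i : measurable (N i).
  rewrite -[X in measurable X]setTI.
  exact: (measurable_response i measurableT (mZ i)).
have aeN i : {ae P, forall w, dens D i (Y D i w) != 0}.
  exists (N i); split=> // w /= gi0; apply: contrapT => wN; apply: gi0.
  by apply/eqP => gi0; apply: wN.
have aeN' : {ae P, forall w, forall i, dens D i (Y D i w) != 0}.
  exact: filter_forall.
apply: filterS aeN' => w w0.
apply: prodr_gt0 => i _; rewrite mxE lt_def w0 /=.
by case: (gm i).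
Qed.

Lemma measurable_true_dens : measurable_fun setT (fun w : Omega D => true_dens D (Yvec w)).
Proof.
have [[_ gm _ _] _ _ _] := model.
apply: measurable_prod => i _; under eq_fun do rewrite mxE.
by apply: measurableT_comp; [case: (gm i)|exact: measurable_response].
Qed.

(** The part of the divergence depending on [beta] is minus the log-likelihood. *)
Lemma KL_qll beta : KL b D beta =
  (\int[P]_w (ln (true_dens D (Yvec w)) - qll b D (Yvec w) beta)%:E)%E.
Proof.
have mq : measurable_fun setT (fun w : Omega D => qll b D (Yvec w) beta).
  by have /integrableP[/measurable_EFinP] := integrable_qll beta.
rewrite /KL expectation.unlock; apply: ae_eq_integral => //.
- apply/measurable_EFinP; apply: (measurableT_comp (@measurable_ln R)).
  rewrite /working_dens; under eq_fun do rewrite -expRN.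
  apply: measurable_funM; first exact: measurable_true_dens.
  by apply: measurableT_comp => //; exact: measurableT_comp.
- apply/measurable_EFinP; apply: measurable_funB => //.
  by apply: (measurableT_comp (@measurable_ln R)); exact: measurable_true_dens.
- apply: filterS true_dens_gt0_ae => w td0 _ /=; congr EFin.
  by rewrite lnM ?posrE ?invr_gt0 ?expR_gt0 // lnV ?posrE ?expR_gt0 // expRK.
Qed.

(** Differences of divergences are differences of mean log-likelihoods, provided that
    the remaining term is integrable; [integral_lt_add] takes care of this. *)
Lemma mean_qll_max beta : qll b D (EY D) beta <= qll b D (EY D) (beta0 D).
Proof.
have [_ _ KLmin _] := model; have [-> //|bb0] := eqVneq beta (beta0 D).
have := KLmin _ bb0; rewrite !KL_qll => lt_KL.
pose g (w : Omega D) := qll b D (Yvec w) (beta0 D) - qll b D (Yvec w) beta.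
have ig : integrable g.
  apply: integrable_realD; first exact: integrable_qll.
  by under eq_fun do rewrite -mulN1r; apply: integrable_realZ; exact: integrable_qll.
have : (0 < \int[P]_w (g w)%:E)%E.
  pose f (w : Omega D) := ln (true_dens D (Yvec w)) - qll b D (Yvec w) (beta0 D).
  apply: (@integral_lt_add _ _ _ _ f g _ ig).
    apply: measurable_funB; last first.
      by have /integrableP[/measurable_EFinP] := integrable_qll (beta0 D).
    by apply: (measurableT_comp (@measurable_ln R)); exact: measurable_true_dens.
  apply: lt_le_trans lt_KL _; rewrite le_eqVlt; apply/orP; left; apply/eqP.
  by apply: eq_integral => w _; rewrite /f /g addrA subrK.
rewrite /g; under eq_integral do rewrite EFinB.
rewrite integralB //; [|exact: integrable_qll|exact: integrable_qll].
by rewrite !integral_qll -EFinB lte_fin subr_gt0 => /ltW.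
Qed.

End moments.

(** * Localization and expansion at a fixed sample size *)

Lemma relative_deviation (R : realType) (e a q : R) :
  - (e * a) <= q - a -> q - a <= e * a -> (1 - e) * a <= q <= (1 + e) * a.
Proof. by move=> *; apply/andP; split; lra. Qed.

Lemma ln_sqrt (R : realType) (x : R) : 0 <= x -> ln (Num.sqrt x) = ln x / 2.
Proof. by move=> x0; rewrite -powR12_sqrt // ln_powR mulrC. Qed.

Section fixed_sample_size.
Context {R : realType} (b : R -> R) {n d : nat} (D : glm_data R n d).
Hypotheses (bC2 : cumulant_function b) (model : glm_setting b D).
Hypothesis m2 : forall i, exists K : R,
  ('E_(Pr D)[fun w => (Y D i w ^+ 2)%R] <= K%:E)%E.
Local Notation P := (Pr D).
Local Notation B := (Bmx D).
Local Notation A0 := (Amx b D (beta0 D)).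

Lemma model_dim_gt0 : (0 < d)%N.
Proof. by have [_ [d0 _ _] _ _] := model. Qed.

Lemma design_inj (v : 'cV[R]_d) : X D *m v = 0 -> v = 0.
Proof.
have [_ [_ rkX _] _ _] := model => Xv0.
have : row_free (X D)^T by rewrite /row_free mxrank_tr rkX.
move=> rf; have := mulmx_free_eq0 v^T rf; rewrite -trmx_mul Xv0 trmx0 eqxx.
by move=> /esym/eqP/(congr1 trmx); rewrite trmxK trmx0.
Qed.

Lemma Bmx_pd : pdmx B.
Proof.
apply: pdmx_trmul; first exact: design_inj.
have [[_ _ _ uY] _ _ _] := model.
exact: psdmx_unit_pd (covY_psdmx m2) uY.
Qed.

Lemma Amx_pd beta : pdmx (Amx b D beta).
Proof.
apply: pdmx_trmul; first exact: design_inj.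
split=> [|v v0]; first by rewrite /Sigma tr_diag_mx.
rewrite qform_Sigma.
have t0 i : 0 <= derive1n 2 b (linpred D beta i 0) * v i 0 ^+ 2.
  by rewrite mulr_ge0 ?sqr_ge0 // ltW // derive2_gt0.
have [i vi] : exists i, v i 0 != 0.
  apply: contrapT => nv; move/eqP: v0; apply; apply/colP => i; rewrite mxE.
  by apply: contrapT => vi; apply: nv; exists i; apply/eqP.
rewrite (bigD1 i) //=; apply: ltr_wpDr; first by apply: sumr_ge0 => j _; exact: t0.
by rewrite mulr_gt0 ?derive2_gt0 // lt_def sqr_ge0 sqrf_eq0 vi.
Qed.

(** The squared norm of [B^(-1/2) X^T (Y - EY)], the normalized gradient of the
    log-likelihood at [beta0]. *)
Definition score2 (w : Omega D) : R :=
  qform (X D *m invmx B *m (X D)^T) (centered w).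

Lemma isqrt_Bmx : [/\ (isqrtmx B)^T = isqrtmx B,
  isqrtmx B *m isqrtmx B = invmx B & isqrtmx B *m sqrtmx B = 1%:M].
Proof.
have [symS SS uS] := pdmx_sqrt Bmx_pd; split.
- by rewrite /isqrtmx trmx_inv symS.
- apply: (can_inj (mulKmx (pdmx_unit Bmx_pd))).
  rewrite (mulmxV (pdmx_unit Bmx_pd)) -{1}SS /isqrtmx -!mulmxA.
  by rewrite [_ *m (invmx _ *m _)]mulmxA mulmxV // mul1mx mulmxV.
- by rewrite mulVmx.
Qed.

Lemma score2E w : score2 w = qform 1%:M (isqrtmx B *m (X D)^T *m centered w).
Proof.
have [symI II _] := isqrt_Bmx.
rewrite -qform_trmul /score2 trmx_mul trmxK symI mulmx1.
by rewrite mulmxA -(mulmxA (X D) (isqrtmx B)) II.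
Qed.

Lemma score2_ge0 w : 0 <= score2 w.
Proof. by rewrite score2E qform1 sumr_ge0 // => i _; exact: sqr_ge0. Qed.

(** Cauchy-Schwarz between [B^(-1/2) X^T (Y - EY)] and [B^(1/2) v]. *)
Lemma score2_ge w v : (((centered w)^T *m (X D *m v)) 0 0) ^+ 2 <=
  score2 w * qform B v.
Proof.
have [symI _ IS] := isqrt_Bmx.
rewrite -(qform_sqrt _ Bmx_pd) score2E.
apply: le_trans (cauchy_schwarz _ _); rewrite !trmx_mul symI trmxK.
by rewrite -!mulmxA [isqrtmx B *m (_ *m v)]mulmxA IS mul1mx.
Qed.

Lemma measurable_score2 : measurable_fun setT score2.
Proof.
rewrite /score2; under eq_fun do rewrite qformE.
apply: measurable_sum => i; apply: measurable_sum => j.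
by apply: measurable_funM => //; apply: measurable_funM; exact: measurable_centered.
Qed.

(** The expectation is the trace of [X B^(-1) X^T cov(Y)], which equals the trace of
    [B^(-1) B]. *)
Lemma integral_score2 : (\int[P]_w (score2 w)%:E = d%:R%:E)%E.
Proof.
rewrite integral_qform_centered //; congr EFin.
transitivity (\tr (X D *m invmx B *m (X D)^T *m (covY D)^T)).
  rewrite /mxtrace; apply: eq_bigr => i _; rewrite mxE.
  by apply: eq_bigr => j _; rewrite [_^T j i]mxE.
have [-> _] := covY_psdmx m2.
rewrite -!mulmxA mxtrace_mulC -!mulmxA [_ *m (covY D *m _)]mulmxA.
by rewrite mulVmx ?mxtrace1 // pdmx_unit //; exact: Bmx_pd.
Qed.

Definition small_score (c : R) : set (Omega D) := [set w | score2 w < c].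

Lemma measurable_small_score c : measurable (small_score c).
Proof.
rewrite -[X in measurable X]setTI; have -> : small_score c = score2 @^-1` `]-oo, c[.
  by apply/seteqP; split=> w /=; rewrite in_itv.
exact: measurable_score2.
Qed.

Lemma prob_small_score c : 0 < c -> (1 - (d%:R / c)%:E <= P (small_score c))%E.
Proof.
move=> c0; have mE := measurable_small_score c.
have PC : (P (~` small_score c) <= (d%:R / c)%:E)%E.
  have : (c%:E * P (setT `&` [set w | c%:E <= `|(score2 w)%:E|]) <=
      \int[P]_w `|(score2 w)%:E|)%E.
    by apply: le_integral_abse => //; apply/measurable_EFinP/measurable_score2.
  under eq_integral do rewrite /= ger0_norm ?score2_ge0 //.
  rewrite integral_score2 setTI.
  have -> : [set w | (c%:E <= `|(score2 w)%:E|)%E] = ~` small_score c.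
    apply/seteqP; split=> w /=; rewrite lee_fin ger0_norm ?score2_ge0 //.
      by rewrite leNgt => /negP.
    by move=> /negP; rewrite -leNgt.
  by rewrite EFinM muleC lee_pdivlMr.
have -> : P (small_score c) = (1 - P (~` small_score c))%E.
  by rewrite -[in LHS](setCK (small_score c)) probability_setC //; exact: measurableC.
exact: leeB.
Qed.

Lemma qform_parallelogram (v u : 'cV[R]_d) :
  qform B (v + u) <= 2 * qform B v + 2 * qform B u.
Proof.
suff <- : qform B (v + u) + qform B (v - u) = 2 * qform B v + 2 * qform B u.
  by rewrite lerDl qform_ge0 //; exact: Bmx_pd.
rewrite /qform [(v + u)^T]linearD [(v - u)^T]linearB /=.
rewrite !(mulmxDl, mulmxDr, mulmxN, mulNmx).
by rewrite !mxE; ring.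
Qed.

Section localization.
Variables (w : Omega D) (bh : 'cV[R]_d) (kappa r2 : R).
Let y : 'cV[R]_n := Yvec w.
Hypothesis (bmax : forall v, qll b D y v <= qll b D y bh).
Hypotheses (kappa_gt0 : 0 < kappa) (r2_gt0 : 0 < r2).
Hypothesis kappaP : forall beta, qform B (beta - beta0 D) <= r2 ->
  forall v, kappa * qform B v <= qform (Amx b D beta) v.
Hypothesis score_lt : score2 w < kappa ^+ 2 * r2 / 4.

(** Since [l] is affine in the observation, replacing the observation by its mean only
    adds a linear function of the displacement. *)
Lemma qll_centered v : qll b D y (beta0 D + v) - qll b D y (beta0 D) =
  ((centered w)^T *m (X D *m v)) 0 0 +
  (qll b D (EY D) (beta0 D + v) - qll b D (EY D) (beta0 D)).
Proof.
have addE (a c : 'M[R]_1) : (a + c) 0 0 = a 0 0 + c 0 0 by rewrite mxE.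
have subE (a c : 'M[R]_1) : (a - c) 0 0 = a 0 0 - c 0 0 by rewrite !mxE.
rewrite /qll /centered /y [(_ - _)^T]linearB /= mulmxBl subE.
by rewrite /linpred !mulmxDr !addE; ring.
Qed.

(** On the sphere the mean log-likelihood has dropped by [kappa r2 / 2]; the square of
    the random linear term is at most [score2 * r2], less than [(kappa r2 / 2)^2]. *)
Lemma qll_sphere_lt v : qform B v = r2 ->
  qll b D y (beta0 D + v) < qll b D y (beta0 D).
Proof.
move=> Bv; rewrite -subr_lt0 qll_centered.
have : qll b D (EY D) (beta0 D + v) - qll b D (EY D) (beta0 D) <= - (kappa * r2 / 2).
  apply: qll_le_quadratic => // [u|t /andP[t0 t1]]; first exact: mean_qll_max.
  rewrite -Bv; apply: kappaP; rewrite addrAC subrr add0r qformZ Bv.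
  by rewrite ler_piMl ?(ltW r2_gt0) // expr_le1.
have := score2_ge w v; rewrite Bv; set c := ((_ *m _) 0 0) => c2 M.
suff : c < kappa * r2 / 2 by lra.
apply: le_lt_trans (ler_norm c) _.
rewrite -(@ltr_pXn2r _ 2) ?nnegrE //; last by rewrite ltW // divr_gt0 // mulr_gt0.
rewrite real_normK ?num_real //; apply: le_lt_trans c2 _.
have -> : (kappa * r2 / 2) ^+ 2 = kappa ^+ 2 * r2 / 4 * r2 by field.
by rewrite ltr_pM2r.
Qed.

(** A maximizer outside the ball would, by concavity, force the log-likelihood on the
    sphere to be at least its value at the center. *)
Lemma qmle_in_ball : qform B (bh - beta0 D) <= r2.
Proof.
rewrite leNgt; apply/negP => hr; pose h := bh - beta0 D.
have qB : 0 < qform B h by exact: lt_trans hr.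
pose s := Num.sqrt (r2 / qform B h).
have s0 : 0 < s by rewrite sqrtr_gt0 divr_gt0.
have s2 : s ^+ 2 = r2 / qform B h by rewrite sqr_sqrtr // ltW // divr_gt0.
have s1 : s <= 1.
  by rewrite -[leRHS]sqrtr1 ler_wsqrtr // ler_pdivrMr // mul1r ltW.
have s01 : 0 <= s <= 1 by rewrite ltW.
have := qll_concave bC2 D y (beta0 D) h s01.
have Bsh : qform B (s *: h) = r2 by rewrite qformZ s2 divfK ?gt_eqF.
have := qll_sphere_lt Bsh; rewrite -subr_lt0 => lt0 le_chord.
have := le_lt_trans le_chord lt0.
have -> : beta0 D + h = bh by rewrite /h addrC subrK.
rewrite pmulr_rlt0 // subr_lt0 => lt1.
by have := le_lt_trans (bmax (beta0 D)) lt1; rewrite ltxx.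
Qed.

End localization.

Section expansion.
Hypothesis n_gt0 : (0 < n)%N.
Let nR_gt0 : 0 < n%:R :> R. Proof. by rewrite ltr0n. Qed.
Let dR_gt0 : 0 < d%:R :> R. Proof. by rewrite ltr0n model_dim_gt0. Qed.
Local Notation Bn := (n%:R^-1 *: B).

Let Bn_pd : pdmx Bn. Proof. by apply: pdmxZ; [rewrite invr_gt0|exact: Bmx_pd]. Qed.

(** The powers of [n] in the definition of the neighbourhood cancel. *)
Lemma nbhdE delta beta : 0 <= delta ->
  nbhd D delta beta <-> qform B (beta - beta0 D) <= d%:R * delta ^+ 2.
Proof.
move=> delta0; rewrite /nbhd /=.
set a := _ `^ _; have a0 : 0 <= a by exact: powR_ge0.
have a2 : a ^+ 2 = d%:R / n%:R.
  have nd0 : 0 <= n%:R / d%:R :> R by rewrite divr_ge0.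
  by rewrite -powR_mulrn // -powRrM mulNr mulVf // powR_inv1 // invf_div.
rewrite -(@ler_pXn2r _ 2) ?nnegrE ?mulr_ge0 ?sqrtr_ge0 //.
rewrite norm2_sqr /hmap qform_sqrt // qform_scale exprMn a2.
rewrite ler_pdivrMl // (_ : n%:R * _ = d%:R * delta ^+ 2) //.
by field; rewrite gt_eqF.
Qed.

Variables (delta kappa eps : R).
Hypotheses (delta_gt0 : 0 < delta) (kappa_gt0 : 0 < kappa)
  (eps01 : 0 <= eps <= 2^-1).
Hypothesis curv : forall beta, nbhd D delta beta ->
  kappa <= lambda_min (Vmx b D beta).
Hypothesis rho_le : (rho b D delta <= (kappa * eps)%:E)%E.

Let r2 := d%:R * delta ^+ 2.
Let r2_gt0 : 0 < r2. Proof. by rewrite mulr_gt0 // exprn_gt0. Qed.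

Lemma curvature_near beta v : qform B (beta - beta0 D) <= r2 ->
  kappa * qform B v <= qform (Amx b D beta) v.
Proof.
move=> /(nbhdE _ (ltW delta_gt0)) /curv kV.
apply: le_trans (lambda_min_relative v Bmx_pd (proj1 (Amx_pd beta))).
by rewrite ler_wpM2r // qform_ge0 //; exact: Bmx_pd.
Qed.

Lemma curvature0 v : kappa * qform B v <= qform A0 v.
Proof.
by apply: curvature_near; rewrite subrr /qform mulmx0 mxE ltW.
Qed.

(** The extreme eigenvalues of [V_n(beta) - V_n] bound the difference of the forms of
    [A_n(beta)] and [A_n] by [rho] times that of [B_n], and [B_n] is at most
    [A_n / kappa]. *)
Lemma curvature_deviation beta v : qform B (beta - beta0 D) <= 4 * r2 ->
  (1 - eps) * qform A0 v <= qform (Amx b D beta) v <= (1 + eps) * qform A0 v.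
Proof.
move=> Br; have beta_in : nbhd D (2 * delta) beta.
  apply/nbhdE; first by rewrite mulr_ge0 // ltW.
  apply: le_trans Br _; rewrite exprMn /r2; lra.
set V := Vmx b D beta - Vmx b D (beta0 D).
have VE : V = isqrtmx B *m (Amx b D beta - A0) *m isqrtmx B.
  by rewrite /V /Vmx mulmxBr mulmxBl.
have symD : (Amx b D beta - A0)^T = Amx b D beta - A0.
  have sA be : (Amx b D be)^T = Amx b D be by case: (Amx_pd be).
  exact: trmx_sub_sym (sA _) (sA _).
have : ((Num.max `|lambda_min V| `|lambda_max V|)%:E <= (kappa * eps)%:E)%E.
  apply: le_trans rho_le; apply: ereal_sup_ubound.
  by exists beta.
rewrite lee_fin ge_max => /andP[lmin lmax].
have qB0 : 0 <= qform B v by rewrite qform_ge0 //; exact: Bmx_pd.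
have eA : kappa * eps * qform B v <= eps * qform A0 v.
  by rewrite mulrAC mulrC ler_wpM2l ?curvature0 //; case/andP: eps01.
have := lambda_min_relative v Bmx_pd symD; have := lambda_max_relative v Bmx_pd symD.
rewrite -VE qformBl => up lo.
have lo' : - (kappa * eps) * qform B v <= lambda_min V * qform B v.
  by rewrite ler_wpM2r // lerNl (le_trans _ lmin) // -normrN ler_norm.
have up' : lambda_max V * qform B v <= kappa * eps * qform B v.
  by rewrite ler_wpM2r // (le_trans (ler_norm _)).
apply: relative_deviation; last exact: le_trans up (le_trans up' eA).
by apply: le_trans (le_trans lo' lo); rewrite mulNr lerN2.
Qed.

Variables (w : Omega D) (bh : 'cV[R]_d) (c2 c3 : R).
Let y : 'cV[R]_n := Yvec w.
Hypothesis (bmax : forall v, qll b D y v <= qll b D y bh).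
Hypothesis (w_small : small_score (kappa ^+ 2 * r2 / 4) w).
Hypotheses (c2_gt0 : 0 < c2)
  (prior_ge : forall beta, nbhd D (2 * delta) beta -> c2 <= prior D (hmap D beta))
  (prior_le : forall beta, prior D (hmap D beta) <= c3).

Let lo := Num.sqrt (1 + eps)^-1 ^+ d -
  expR (- (Num.sqrt (kappa * r2) ^+ 2 / 4)) * Num.sqrt 2 ^+ d.
Let up := Num.sqrt (1 - eps)^-1 ^+ d +
  expR (- (Num.sqrt (kappa * r2) ^+ 2 / 8)) *
  (16 * Num.sqrt d%:R / Num.sqrt (kappa * r2) / Num.sqrt (2 * pi)) ^+ d.

Let bh_near : qform B (bh - beta0 D) <= r2.
Proof. by apply: (qmle_in_ball bmax kappa_gt0 r2_gt0 _ w_small) => *; exact: curvature_near. Qed.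

Let near_bh beta : qform B (beta - bh) <= r2 -> qform B (beta - beta0 D) <= 4 * r2.
Proof.
move=> Br; have -> : beta - beta0 D = (beta - bh) + (bh - beta0 D).
  by rewrite addrA subrK.
apply: le_trans (qform_parallelogram _ _) _; have := bh_near; lra.
Qed.

(** The number [q] is the marginal likelihood divided by the maximal likelihood and by
    the Gaussian integral; [laplace_lower] and [laplace_upper] locate it.  The
    rest is the computation of the determinant of [C^T A_n C], which is
    [n^d / |H_n|] for [C] the inverse square root of [B_n / n]. *)
Lemma log_marginal_expansion : 0 < lo -> exists2 q, c2 * lo <= q <= c3 * up &
  log_marginal b D y = qll b D y bh - ln n%:R / 2 * d%:R +
    2^-1 * ln (\det (Hmx b D)) + ln (alpha D) + ln (2 * pi) / 2 * d%:R + ln q.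
Proof.
move=> lo_gt0; have [_ _ _ [/andP[al0 _] mp p0 _]] := model.
pose C := isqrtmx Bn; have [symS SS uS] := pdmx_sqrt Bn_pd.
have uC : C \in unitmx by rewrite unitmx_inv.
have hK u : hmap D (C *m u) = u by rewrite /hmap /C /isqrtmx mulKVmx.
have p_le u : prior D u <= c3 by rewrite -(hK u).
have p_ge u : qform B (C *m u - bh) <= r2 -> c2 <= prior D u.
  move=> /near_bh Bu; rewrite -[u]hK; apply: prior_ge.
  apply/nbhdE; first by rewrite mulr_ge0 // ltW.
  by rewrite exprMn; move: Bu; rewrite /r2; lra.
have dev beta : qform B (beta - bh) <= r2 -> forall v,
    (1 - eps) * qform A0 v <= qform (Amx b D beta) v <= (1 + eps) * qform A0 v.
  by move=> /near_bh Bb v; exact: curvature_deviation.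
have Jup := laplace_upper bC2 bmax (Amx_pd _) Bmx_pd kappa_gt0 r2_gt0 eps01
  curvature0 dev model_dim_gt0 uC mp p0 p_le.
have Jlo := laplace_lower bC2 bmax (Amx_pd _) Bmx_pd kappa_gt0 r2_gt0 eps01
  curvature0 dev uC mp p0 (ltW c2_gt0) p_ge.
pose M := C^T *m A0 *m C.
have M_pd : pdmx M.
  apply: pdmx_trmul (Amx_pd _) => v Cv0.
  by rewrite -(mulKmx uC v) Cv0 mulmx0.
have M_gt0 : 0 < \det M by exact: pdmx_det_gt0.
pose G := (Num.sqrt (\det M))^-1 * Num.sqrt (2 * pi) ^+ d.
have s2pi : 0 < Num.sqrt (2 * pi) :> R by rewrite sqrtr_gt0 mulr_gt0 // pi_gt0.
have sM : 0 < Num.sqrt (\det M) by rewrite sqrtr_gt0.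
have G_gt0 : 0 < G by rewrite mulr_gt0 ?invr_gt0 // exprn_gt0.
move: Jup Jlo; rewrite -/lo -/up -/M -/G.
set J := likelihood_ratio_integral _ _ _ _ _ _ => Jup Jlo.
have J_fin : J \is a fin_num.
  rewrite fin_numE; apply/andP; split.
    by apply/eqP => JE; move: Jlo; rewrite JE leNgt ltNyr.
  by apply/eqP => JE; move: Jup; rewrite JE leNgt ltry.
(* [G] is the Gaussian integral *)
pose q := fine J / G.
have JE : J = (q * G)%:E by rewrite /q divfK ?gt_eqF // fineK.
move: Jup Jlo; rewrite JE !lee_fin !ler_pM2r // => qup qlo.
exists q; first by rewrite qlo.
have q_gt0 : 0 < q by apply: lt_le_trans qlo; rewrite mulr_gt0.
have int_E : (\int[lebesgue_tuple d]_t
    (expR (qll b D y (hinv D (cvec t))) * prior D (cvec t)) =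
    expR (qll b D y bh) * (q * G)).
  rewrite /Rintegral -[RHS]/(fine (expR (qll b D y bh) * (q * G))%:E) EFinM -JE.
  congr fine; rewrite /J /likelihood_ratio_integral -ge0_integralZl //.
  - apply: eq_integral => t _; rewrite -EFinM; congr EFin.
    rewrite mulrA -expRD; congr (expR _ * _).
    by rewrite addrC subrK.
  - apply/measurable_EFinP/measurable_funM => //.
    apply: measurableT_comp => //; apply: measurable_funB => //.
    exact: measurable_qll_cvec.
  - by move=> t _; rewrite lee_fin mulr_ge0 ?expR_ge0.
have H_gt0 : 0 < \det (Hmx b D).
  rewrite /Hmx det_mulmx det_inv mulr_gt0 ?invr_gt0 ?pdmx_det_gt0 //.
    exact: Amx_pd.
  exact: Bmx_pd.
have detM : \det M = n%:R ^+ d / \det (Hmx b D).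
  have dA : \det A0 != 0 by rewrite gt_eqF // pdmx_det_gt0 //; exact: Amx_pd.
  have dB : \det B != 0 by rewrite gt_eqF // pdmx_det_gt0 //; exact: Bmx_pd.
  have dS : \det (sqrtmx Bn) ^+ 2 = n%:R^-1 ^+ d * \det B.
    by rewrite expr2 -det_mulmx SS detZ.
  have dS0 : \det (sqrtmx Bn) != 0 by rewrite -unitfE -unitmxE.
  have dH : \det (Hmx b D) = (\det A0)^-1 * \det B.
    by rewrite /Hmx det_mulmx det_inv.
  have dC : \det C = (\det (sqrtmx Bn))^-1 by rewrite /C /isqrtmx det_inv.
  have -> : \det M = \det C ^+ 2 * \det A0.
    rewrite /M (det_mulmx (C^T *m A0)) (det_mulmx C^T) det_tr.
    by rewrite mulrAC -expr2.
  rewrite dH dC exprVn dS exprVn.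
  by field; rewrite dA dB expf_neq0 // gt_eqF.
have lnM_E : ln (\det M) = ln n%:R * d%:R - ln (\det (Hmx b D)).
  by rewrite detM ln_div ?posrE ?exprn_gt0 // lnXn // mulr_natr.
have lnG : ln G = - (ln (\det M) / 2) + ln (2 * pi) / 2 * d%:R.
  have -> : ln G = ln (Num.sqrt (\det M))^-1 + ln (Num.sqrt (2 * pi) ^+ d).
    by rewrite -lnM // posrE ?invr_gt0 ?exprn_gt0.
  rewrite lnV ?posrE // lnXn //.
  have pi2 : 0 <= 2 * pi :> R by rewrite mulr_ge0 // pi_ge0.
  by rewrite (ln_sqrt pi2) (ln_sqrt (ltW M_gt0)) mulr_natr.
rewrite /log_marginal int_E.
have e0 := expR_gt0 (qll b D y bh); have qG := mulr_gt0 q_gt0 G_gt0.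
have -> : ln (alpha D * (expR (qll b D y bh) * (q * G))) =
    ln (alpha D) + (qll b D y bh + (ln q + ln G)).
  have eqG := mulr_gt0 e0 qG.
  by rewrite lnM ?posrE // lnM ?posrE // expRK lnM ?posrE.
rewrite lnG lnM_E.
by ring.
Qed.

End expansion.

End fixed_sample_size.

(** * Correction factors tending to one *)

Section rates.
Context {R : realType}.

Lemma sqrt_le_id (x : R) : 1 <= x -> Num.sqrt x <= x.
Proof.
move=> x1; have x0 : 0 <= x by apply: le_trans x1.
rewrite -[leRHS]ger0_norm // -sqrtr_sqr ler_wsqrtr // expr2 ler_peMl //.
Qed.

Lemma sqrt_ge_id (x : R) : 0 <= x <= 1 -> x <= Num.sqrt x.
Proof.
move=> /andP[x0 x1]; rewrite -[leLHS]ger0_norm // -sqrtr_sqr ler_wsqrtr //.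
by rewrite expr2 ler_piMl.
Qed.

(** From [1 + eps <= exp eps], and [sqrt 2 <= e] for the term coming from the outside
    of the ball; its exponent [d (1 - s / 4)] is at most [1 - t / 4] because
    [d >= 1] and [s >= 4]. *)
Lemma lower_factor (d : nat) (eps s t : R) : (0 < d)%N -> 0 <= eps -> 4 <= t <= s ->
  expR (- (eps * d%:R)) - expR (1 - t / 4) <=
  Num.sqrt (1 + eps)^-1 ^+ d -
  expR (- (Num.sqrt (d%:R * s) ^+ 2 / 4)) * Num.sqrt 2 ^+ d.
Proof.
move=> d0 e0 /andP[t4 ts]; have d1 : 1 <= d%:R :> R by rewrite ler1n.
apply: lerB.
  rewrite -mulNr expRM_natr; apply: lerXn2r; rewrite ?nnegrE ?expR_ge0 ?sqrtr_ge0 //.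
  have e1 : 0 < 1 + eps by lra.
  apply: le_trans (sqrt_ge_id _); last first.
    by rewrite invr_ge0 (ltW e1) /= invf_le1 //; lra.
  by rewrite expRN lef_pV2 ?posrE ?expR_gt0 // expR_ge1Dx.
have s2 : Num.sqrt 2 <= expR 1 :> R.
  apply: le_trans (sqrt_le_id _) _; first by lra.
  by have := expR_ge1Dx (1 : R).
have s0 : 0 <= d%:R * s by rewrite mulr_ge0 //; lra.
rewrite sqr_sqrtr //.
apply: (@le_trans _ _ (expR (- (d%:R * s / 4)) * expR 1 ^+ d)).
  by rewrite ler_wpM2l ?expR_ge0 // lerXn2r ?nnegrE ?expR_ge0 ?sqrtr_ge0.
rewrite -expRM_natr -expRD ler_expR mul1r.
have : (d%:R - 1) * (1 - s / 4) <= 0 by rewrite mulr_ge0_le0 //; lra.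
nra.
Qed.

(** For [eps <= 1/2] the inverse of [1 - eps] is at most [exp (2 eps)].  The base of the
    last power is at most [16 / sqrt s], hence at most one when [s >= 256]. *)
Lemma upper_factor (d : nat) (eps s t : R) : (0 < d)%N ->
  0 <= eps <= 2^-1 -> 256 <= t <= s ->
  Num.sqrt (1 - eps)^-1 ^+ d + expR (- (Num.sqrt (d%:R * s) ^+ 2 / 8)) *
    (16 * Num.sqrt d%:R / Num.sqrt (d%:R * s) / Num.sqrt (2 * pi)) ^+ d <=
  expR (2 * (eps * d%:R)) + expR (- (t / 8)).
Proof.
move=> d0 /andP[e0 e1] /andP[t4 ts]; have d1 : 1 <= d%:R :> R by rewrite ler1n.
have s256 : 256 <= s by lra.
apply: lerD.
  rewrite mulrA expRM_natr; apply: lerXn2r; rewrite ?nnegrE ?expR_ge0 ?sqrtr_ge0 //.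
  have e1' : 0 < 1 - eps by lra.
  apply: le_trans (sqrt_le_id _) _.
    by rewrite -[leLHS]invr1 lef_pV2 ?posrE //; lra.
  rewrite -[leRHS]invrK -expRN lef_pV2 ?posrE ?expR_gt0 //.
  rewrite expRN -[leLHS]mul1r ler_pdivrMr ?expR_gt0 //.
  apply: (@le_trans _ _ ((1 - eps) * (1 + 2 * eps))); first by nra.
  by rewrite ler_pM2l // expR_ge1Dx.
have s0 : 0 <= d%:R * s by rewrite mulr_ge0 //; lra.
rewrite sqr_sqrtr //.
apply: (@le_trans _ _ (expR (- (d%:R * s / 8)))); last first.
  by rewrite ler_expR; nra.
rewrite ler_piMr ?expR_ge0 // exprn_ile1 //.
have sd : 0 < Num.sqrt d%:R :> R by rewrite sqrtr_gt0; lra.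
have ss : 16 <= Num.sqrt s.
  by rewrite -[leLHS]ger0_norm // -sqrtr_sqr ler_wsqrtr //; lra.
have sp : 1 <= Num.sqrt (2 * pi) :> R.
  rewrite -[leLHS]sqrtr1 ler_wsqrtr //; have := pi_ge2 R; lra.
rewrite sqrtrM ?ler0n //.
rewrite ler_pdivrMr; last by lra.
rewrite mul1r; apply: le_trans sp.
rewrite ler_pdivrMr ?mulr_gt0 //; last by lra.
by rewrite mul1r mulrC ler_pM2l.
Qed.

Lemma ln_nat_ge (A : R) : \forall n \near \oo, A <= ln n%:R.
Proof.
near=> n; have h : expR A < n%:R by near: n; exact: nbhs_infty_gtr.
rewrite -[A]expRK ler_ln ?posrE ?expR_gt0 ?(ltW h) //.
exact: lt_trans (expR_gt0 _) h.
Unshelve. all: by end_near. Qed.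

(** Take for [c] the point of [[c2, c3]] nearest to [q]. *)
Lemma clamp_ln (c2 c3 L U q : R) : 0 < c2 <= c3 -> 0 < L -> 0 < U ->
  c2 * L <= q <= c3 * U ->
  exists c, c2 <= c <= c3 /\ `|ln q - ln c| <= `|ln L| + `|ln U|.
Proof.
move=> /andP[c20 c23] L0 U0 /andP[qL qU]; have c30 := lt_le_trans c20 c23.
have q0 : 0 < q by apply: lt_le_trans qL; rewrite mulr_gt0.
have [q2|q2] := ltP q c2.
  exists c2; rewrite lexx; split => //.
  have : ln q <= ln c2 by rewrite ler_ln ?posrE // ltW.
  have : ln c2 + ln L <= ln q by rewrite -lnM ?posrE // ler_ln ?posrE // mulr_gt0.
  have := normr_ge0 (ln U); have := ler_norm (- ln L); rewrite normrN.
  by move=> *; rewrite ler_norml; apply/andP; split; lra.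
have [q3|q3] := ltP c3 q.
  exists c3; rewrite lexx c23; split => //.
  have : ln c3 <= ln q by rewrite ler_ln ?posrE // ltW.
  have : ln q <= ln c3 + ln U by rewrite -lnM ?posrE // ler_ln ?posrE // mulr_gt0.
  have := normr_ge0 (ln L); have := ler_norm (ln U).
  by move=> *; rewrite ler_norml; apply/andP; split; lra.
by exists q; rewrite q2 q3 subrr normr0 addr_ge0.
Qed.

Lemma cvg_expR_to1 (x : R^nat) : x n @[n --> \oo] --> (0 : R) ->
  expR (x n) @[n --> \oo] --> (1 : R).
Proof. by move=> x0; rewrite -expR0; apply: continuous_cvg => //; exact: continuous_expR. Qed.

Lemma cvg_expRN_ln (a k : R) : 0 < k ->
  expR (a - k * ln n%:R) @[n --> \oo] --> (0 : R).
Proof.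
move=> k0; have -> : (fun n : nat => expR (a - k * ln n%:R)) =
    (fun x : R => expR (- x)) \o (fun n => k * ln n%:R - a).
  by apply/funext => n /=; rewrite opprB.
apply: cvg_comp; last exact: cvgr_expR.
apply/cvgryPge => A; near=> n.
have : (A + a) / k <= ln n%:R by near: n; exact: ln_nat_ge.
by rewrite ler_pdivrMr // mulrC lerBrDr.
Unshelve. all: by end_near. Qed.

Lemma cvg_abs_ln (u : R^nat) : u n @[n --> \oo] --> (1 : R) ->
  `|ln (u n)| @[n --> \oo] --> (0 : R).
Proof.
move=> u1; rewrite -(normr0 R) -ln1.
apply: cvg_norm; apply: continuous_cvg => //; exact: continuous_ln.
Qed.

End rates.

Section approximation.
Context {R : realType} (b : R -> R) {n d : nat} (D : glm_data R n d).
Hypotheses (bC2 : cumulant_function b) (model : glm_setting b D).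
Hypothesis m2 : forall i, exists K : R,
  ('E_(Pr D)[fun w => (Y D i w ^+ 2)%R] <= K%:E)%E.
Variables (delta kappa eps t c2 c3 : R) (bhat : 'cV[R]_n -> 'cV[R]_d).
Let L := expR (- (eps * d%:R)) - expR (1 - t / 4).
Let U := expR (2 * (eps * d%:R)) + expR (- (t / 8)).

(** The expansion at a fixed [n], with the unknown factor [q] split into a constant of
    [[c2, c3]] and a remainder controlled by [L] and [U]. *)
Lemma log_marginal_approximation (w : Omega D) : (0 < n)%N ->
  0 < delta -> 0 < kappa -> 0 <= eps <= 2^-1 -> 256 <= t <= kappa * delta ^+ 2 ->
  0 < L -> is_qmle b D bhat ->
  (forall beta, nbhd D delta beta -> kappa <= lambda_min (Vmx b D beta)) ->
  (rho b D delta <= (kappa * eps)%:E)%E ->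
  0 < c2 -> (forall beta, nbhd D (2 * delta) beta -> c2 <= prior D (hmap D beta)) ->
  (forall beta, prior D (hmap D beta) <= c3) ->
  small_score (kappa ^+ 2 * (d%:R * delta ^+ 2) / 4) w ->
  exists c rem, [/\ c2 <= c <= c3, `|rem| <= `|ln L| + `|ln U| &
    log_marginal b D (Yvec w) =
      qll b D (Yvec w) (bhat (Yvec w)) - ln n%:R / 2 * d%:R
      + 2^-1 * ln (\det (Hmx b D)) + ln (alpha D)
      + ln (2 * pi) / 2 * d%:R + ln c + rem].
Proof.
move=> n0 delta0 kappa0 eps01 /andP[t256 ts] L0 qmle curv rho_le c20 pge ple wE.
have d0 := model_dim_gt0 model.
have e0 : 0 <= eps by case/andP: eps01.
have U0 : 0 < U by rewrite addr_gt0 ?expR_gt0.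
have sE : kappa * (d%:R * delta ^+ 2) = d%:R * (kappa * delta ^+ 2) by rewrite mulrCA.
have c23 : c2 <= c3.
  apply: le_trans (ple (beta0 D)); apply: pge; apply/(nbhdE model m2 n0).
    by rewrite mulr_ge0 // ltW.
  by rewrite subrr /qform mulmx0 mxE mulr_ge0 // sqr_ge0.
have t4s : 4 <= t <= kappa * delta ^+ 2.
  by rewrite ts andbT; apply: le_trans t256; rewrite ler_nat.
have t256s : 256 <= t <= kappa * delta ^+ 2 by rewrite t256.
have Llo := lower_factor d0 e0 t4s; have upU := upper_factor d0 eps01 t256s.
rewrite -sE in Llo upU.
have lo0 := lt_le_trans L0 Llo.
have [q /andP[qlo qup] ->] := log_marginal_expansion bC2 model m2 n0 delta0 kappa0
  eps01 curv rho_le (fun v => qmle (Yvec w) v) wE c20 pge ple lo0.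
have q_in : c2 * L <= q <= c3 * U.
  apply/andP; split.
    by apply: le_trans qlo; rewrite ler_pM2l.
  by apply: le_trans qup _; rewrite ler_wpM2l // (le_trans (ltW c20)).
have c203 : 0 < c2 <= c3 by rewrite c20.
have [c [c_in le_rem]] := clamp_ln c203 L0 U0 q_in.
exists c, (ln q - ln c); split => //.
by rewrite -[in RHS]addrA [ln c + _]addrC subrK.
Qed.

End approximation.

(** * Growth of the constants *)

Section growth.
Context {R : realType}.

Lemma powR_ge1 (a p : R) : 1 <= a -> 0 <= p -> 1 <= a `^ p.
Proof.
move=> a1 p0; apply: (@le_trans _ _ (1 `^ p)); first by rewrite powR1.
apply: ge0_ler_powR => //.
- by rewrite nnegrE.
- by rewrite nnegrE (le_trans _ a1).
Qed.

(** The left-hand side tends to infinity; the right-hand side is [T^2 / d]. *)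
Lemma curvature_radius_ge (n : nat) (c0 c1 r : R) : (0 < n)%N -> 0 < c0 -> 0 < c1 ->
  0 < r -> 0 <= ln (n%:R : R) ->
  c1 * c0 * ln n%:R <= c1 * n%:R `^ (- r) * delta_seq c0 r n ^+ 2.
Proof.
move=> n0 c00 c10 r0 ln0; have nR : 1 <= n%:R :> R by rewrite ler1n.
have nR0 : 0 < n%:R :> R by rewrite ltr0n.
have c0ln : 0 <= c0 * ln n%:R by rewrite mulr_ge0 // ltW.
rewrite /delta_seq exprMn sqr_sqrtr //.
have -> : (n%:R `^ r) ^+ 2 = n%:R `^ r * n%:R `^ r :> R by rewrite expr2.
have nn : n%:R `^ (- r) * n%:R `^ r = 1 :> R.
  by rewrite -powRD ?(gt_eqF nR0) ?implybT // addNr powRr0.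
rewrite (_ : _ * (_ * _ * (c0 * ln n%:R)) =
  n%:R `^ r * (n%:R `^ (- r) * n%:R `^ r) * (c1 * c0 * ln n%:R)); last by ring.
rewrite nn mulr1 ler_peMl //; first by rewrite !mulr_ge0 // ltW.
by rewrite powR_ge1 // ltW.
Qed.

(** The threshold for [score2] is [d] times a quarter of this quantity, in which the
    powers of [n] cancel. *)
Lemma sqr_curvature_radius (n : nat) (c0 c1 r : R) : (0 < n)%N -> 0 < c0 ->
  0 <= ln (n%:R : R) ->
  (c1 * n%:R `^ (- r)) ^+ 2 * delta_seq c0 r n ^+ 2 = c1 ^+ 2 * c0 * ln n%:R.
Proof.
move=> n0 c00 ln0; have nR0 : 0 < n%:R :> R by rewrite ltr0n.
have c0ln : 0 <= c0 * ln n%:R by rewrite mulr_ge0 // ltW.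
rewrite /delta_seq !exprMn sqr_sqrtr //.
have nn : n%:R `^ (- r) * n%:R `^ r = 1 :> R.
  by rewrite -powRD ?(gt_eqF nR0) ?implybT // addNr powRr0.
rewrite (_ : _ * _ = (n%:R `^ (- r) * n%:R `^ r) ^+ 2 * (c1 ^+ 2 * c0 * ln n%:R));
  last by ring.
by rewrite nn expr1n mul1r.
Qed.

(** The left-hand side is [d eps] when [u] is [rho] times [n^((1 - r)/3)].  The exponents
    match since [(1 - r)/3 - r = (1 - 4r)/3], and the logarithmic factor of the
    bound on [d] is at most one. *)
Lemma relative_error_rate (n d : nat) (c1 r u : R) : (0 < n)%N -> 0 < c1 ->
  1 <= ln (n%:R : R) -> 0 <= u ->
  u / (n%:R `^ ((1 - r) / 3) * (c1 * n%:R `^ (- r))) * d%:R <=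
  c1^-1 * (u * (d%:R / (n%:R `^ ((1 - 4 * r) / 3) * (ln n%:R) `^ (- (2 / 3))))).
Proof.
move=> n0 c10 ln1 u0; have nR0 : 0 < n%:R :> R by rewrite ltr0n.
have nn : n%:R `^ ((1 - r) / 3) * n%:R `^ (- r) = n%:R `^ ((1 - 4 * r) / 3) :> R.
  by rewrite -powRD ?(gt_eqF nR0) ?implybT //; congr (_ `^ _); field.
rewrite mulrCA nn invfM mulrCA -!mulrA ler_pM2l ?invr_gt0 //.
rewrite ler_wpM2l // mulrC ler_wpM2l ?ler0n // lef_pV2 ?posrE.
- rewrite ler_piMr ?powR_ge0 // powRN invf_le1; last by rewrite powR_gt0; lra.
  by apply: powR_ge1; lra.
- by rewrite powR_gt0.
- by rewrite mulr_gt0 ?powR_gt0 //; lra.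
Qed.

End growth.

(** * The expansion with probability tending to one *)

Lemma ln_nat_gt0 (R : realType) : \forall n \near \oo, 0 < ln (n%:R : R).
Proof.
near=> n; apply: (@lt_le_trans _ _ 1) => //; near: n; exact: ln_nat_ge.
Unshelve. all: by end_near. Qed.

Theorem theorem5 (R : realType) (b : R -> R) (d : nat -> nat)
    (D : forall n, glm_data R n (d n))
    (bhat : forall n, 'cV[R]_n -> 'cV[R]_(d n))
    (H c0 c1 r c2 c3 : R) :
  cumulant_function b ->
  (forall n, (0 < n)%N -> glm_setting b (D n)) ->
  second_moments_bounded D ->
  (forall n, (0 < n)%N -> is_qmle b (D n) (@bhat n)) ->
  subgaussian_condition D H ->
  curvature_condition b D H c0 c1 r ->
  lyapunov_condition D ->
  prior_condition b D c0 r c2 c3 ->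
  exists (c rem : forall n, Omega (D n) -> R) (E : forall n, set (Omega (D n)))
         (eps : nat -> R),
    [/\ forall n, measurable (E n),
        (Pr (D n) (E n) @[n --> \oo] --> 1%E),
        eps n @[n --> \oo] --> (0 : R) &
        forall n (w : Omega (D n)), E n w ->
          [/\ c2 <= c n w <= c3,
              `|rem n w| <= eps n &
              let y := Yvec w in
              log_marginal b (D n) y =
                qll b (D n) y (bhat n y) - ln n%:R / 2 * (d n)%:R
                + 2^-1 * ln (\det (Hmx b (D n))) + ln (alpha (D n))
                + ln (2 * pi) / 2 * (d n)%:R + ln (c n w) + rem n w]].
Proof.
move=> bC2 glm [K m2] qmle [H0 _] curvature _ [[c20 c30] prior_ge prior_le rho0].
have [[c10 c0H /andP[r0 r4]] curv _ dim0] := curvature.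
have c00 : 0 < c0.
  by apply: lt_trans c0H; rewrite !mulr_gt0 // invr_gt0 exprn_gt0.
pose delta n := delta_seq c0 r n.
pose kappa n : R := c1 * n%:R `^ (- r).
(* the rate at which [rho] is assumed to vanish *)
pose a n : R := n%:R `^ ((1 - r) / 3).
pose u n : R := `|fine (rho b (D n) (delta n) * (a n)%:E)|.
pose v n : R := (d n)%:R / (n%:R `^ ((1 - 4 * r) / 3) * (ln n%:R) `^ (- (2 / 3))).
(* this is [|rho| / kappa] whenever [rho] is finite, and nonnegative in any case *)
pose eps n : R := u n / (a n * kappa n).
pose x n : R := eps n * (d n)%:R.
pose t n : R := c1 * c0 * ln n%:R.
pose L n := expR (- x n) - expR (1 - t n / 4).
pose U n := expR (2 * x n) + expR (- (t n / 8)).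
have [rho_fin u0'] : (\forall n \near \oo, rho b (D n) (delta n) * (a n)%:E \is a fin_num)%E /\
    (fine \o (fun n => rho b (D n) (delta n) * (a n)%:E)%E) n @[n --> \oo] --> (0 : R).
  exact/fine_cvgP.
have u0 : u n @[n --> \oo] --> (0 : R) by rewrite -(normr0 R); exact: cvg_norm.
have a_gt0 n : (0 < n)%N -> 0 < a n by move=> n0; rewrite powR_gt0 // ltr0n.
have k_gt0 n : (0 < n)%N -> 0 < kappa n.
  by move=> n0; rewrite mulr_gt0 // powR_gt0 // ltr0n.
have d_ge1 n : (0 < n)%N -> 1 <= (d n)%:R :> R.
  by move=> n0; rewrite ler1n (model_dim_gt0 (glm n n0)).
have eps_ge0 n : 0 <= eps n.
  by rewrite /eps divr_ge0 ?normr_ge0 // !mulr_ge0 ?powR_ge0 // ltW.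
have x0 : x n @[n --> \oo] --> (0 : R).
  apply: (@squeeze_cvgr _ _ _ _ (cst 0) (fun n => c1^-1 * (u n * v n))).
  - near=> n.
    have n0 : (0 < n)%N by near: n; exact: nbhs_infty_gt.
    have ln1 : 1 <= ln n%:R :> R by near: n; exact: ln_nat_ge.
    apply/andP; split; first by rewrite /= mulr_ge0 // ler0n.
    by apply: relative_error_rate => //; exact: normr_ge0.
  - exact: cvg_cst.
  - rewrite -[X in _ --> X](mulr0 c1^-1); apply: cvgM; first exact: cvg_cst.
    by rewrite -[X in _ --> X](mul0r 0); exact: cvgM.
have expt (e k : R) : 0 < k -> expR (e - t n * k) @[n --> \oo] --> (0 : R).
  move=> k0; under eq_fun do rewrite /t mulrAC.
  by apply: cvg_expRN_ln; rewrite !mulr_gt0.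
have L1 : L n @[n --> \oo] --> (1 : R).
  rewrite -[X in _ --> X]subr0; apply: cvgB; last exact: expt.
  by apply: cvg_expR_to1; rewrite -oppr0; exact: cvgN.
have U1 : U n @[n --> \oo] --> (1 : R).
  rewrite -[X in _ --> X]addr0; apply: cvgD.
    apply: cvg_expR_to1; rewrite -(mulr0 2); apply: cvgM => //; exact: cvg_cst.
  by under eq_fun do rewrite -[- (_ / _)]add0r; exact: expt.
pose level n : R := kappa n ^+ 2 * ((d n)%:R * delta n ^+ 2) / 4.
(* the conditions on [n] under which [log_marginal_approximation] applies *)
pose regular n := [/\ (0 < n)%N /\ 0 < delta n,
  forall beta, nbhd (D n) (delta n) beta -> kappa n <= lambda_min (Vmx b (D n) beta),
  (rho b (D n) (delta n) <= (kappa n * eps n)%:E)%E,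
  eps n <= 2^-1 /\ 0 < L n & 256 <= t n <= kappa n * delta n ^+ 2].
have near_regular : \forall n \near \oo, regular n.
  near=> n.
  have n0 : (0 < n)%N by near: n; exact: nbhs_infty_gt.
  have ln1 : 1 <= ln n%:R :> R by near: n; exact: ln_nat_ge.
  have ln0 : 0 <= ln n%:R :> R by apply: le_trans ln1.
  have curv_n : forall beta, nbhd (D n) (delta_seq c0 r n) beta ->
    c1 * n%:R `^ (- r) < lambda_min (Vmx b (D n) beta) by near: n; exact: curv.
  have fin_n : (rho b (D n) (delta n) * (a n)%:E)%E \is a fin_num by near: n.
  have x_small : x n < 2^-1 by near: n; apply: (cvgr_lt 0 x0); rewrite invr_gt0.
  have L_gt0 : 0 < L n by near: n; apply: (cvgr_gt 1 L1); exact: ltr01.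
  have t_large : 256 / (c1 * c0) <= ln n%:R by near: n; exact: ln_nat_ge.
  have an0 := a_gt0 n n0; have kn0 := k_gt0 n n0.
  split.
  - split=> //; rewrite /delta /delta_seq mulr_gt0 ?powR_gt0 ?ltr0n //.
    by rewrite sqrtr_gt0 mulr_gt0 // (lt_le_trans _ ln1).
  - move=> beta beta_in; exact/ltW/curv_n.
  - move: fin_n; rewrite /eps /u; case: (rho b (D n) (delta n)) => [s _||].
    + rewrite -EFinM lee_fin /= normrM (gtr0_norm an0).
      rewrite (_ : _ * _ = `|s|) ?ler_norm //.
      by field; rewrite !gt_eqF.
    + by rewrite gt0_mulye // lte_fin.
    + by rewrite gt0_mulNye // lte_fin.
  - split.
      apply: (@le_trans _ _ (x n)).
        by rewrite ler_peMr // d_ge1.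
      exact: ltW.
    exact: L_gt0.
  - rewrite curvature_radius_ge // andbT.
    by move: t_large; rewrite ler_pdivrMr ?mulr_gt0 // mulrC.
have m2n n : (0 < n)%N -> forall i, exists K : R,
    ('E_(Pr (D n))[fun w => (Y (D n) i w ^+ 2)%R] <= K%:E)%E.
  by move=> n0 i; exists K; exact: m2.
(* the finitely many irregular [n] get the empty event *)
pose E n : set (Omega (D n)) :=
  if pselect (regular n) then small_score (level n) else set0.
have mE n : measurable (E n).
  rewrite /E; case: pselect => ? /=; last exact: measurable0.
  exact: measurable_small_score.
have PE : (Pr (D n) (E n) @[n --> \oo] --> 1%E).
  (* [f n] is [level n / d n] *)
  pose f n : R := c1 ^+ 2 * c0 / 4 * ln n%:R.
  have k0 : 0 < c1 ^+ 2 * c0 / 4 by rewrite !mulr_gt0 ?exprn_gt0.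
  have f0 : (f n)^-1 @[n --> \oo] --> (0 : R).
    apply/gtr0_cvgV0; first by near=> n; rewrite /f mulr_gt0 //; near: n; exact: ln_nat_gt0.
    apply/cvgryPge => A; near=> n.
    by rewrite /f mulrC -ler_pdivrMr //; near: n; exact: ln_nat_ge.
  apply: (@squeeze_cvge _ _ _ _ (fun n => (1 - (f n)^-1)%:E) _ (cst 1%E)).
  - near=> n.
    have [[n0 dl0] _ _ _ _] : regular n by near: n.
    have ln0 : 0 < ln n%:R :> R by near: n; exact: ln_nat_gt0.
    rewrite probability_le1 // andbT.
    have level_gt0 : 0 < level n.
      have dn0 : 0 < (d n)%:R :> R by exact: lt_le_trans (d_ge1 n n0).
      apply: divr_gt0 => //; apply: mulr_gt0; first exact/exprn_gt0/k_gt0.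
      by apply: mulr_gt0 => //; exact: exprn_gt0.
    have -> : (f n)^-1 = (d n)%:R / level n.
      have dn0 : (d n)%:R != 0 :> R by rewrite pnatr_eq0 -lt0n (model_dim_gt0 (glm n n0)).
      rewrite /f /level mulrCA sqr_curvature_radius // ?ltW //.
      by field; rewrite dn0 !gt_eqF.
    rewrite /E; case: pselect => [?|] /=; last by case; near: n.
    exact: (prob_small_score (glm n n0) (m2n n n0)).
  - apply: cvg_EFin; first by near=> n.
    by rewrite -[X in _ --> X]subr0; apply: cvgB; [exact: cvg_cst|exact: f0].
  - exact: cvg_cst.
have approx n w : exists p : R * R, E n w -> [/\ c2 <= p.1 <= c3,
    `|p.2| <= `|ln (L n)| + `|ln (U n)| &
    log_marginal b (D n) (Yvec w) =
      qll b (D n) (Yvec w) (bhat n (Yvec w)) - ln n%:R / 2 * (d n)%:R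
      + 2^-1 * ln (\det (Hmx b (D n))) + ln (alpha (D n))
      + ln (2 * pi) / 2 * (d n)%:R + ln p.1 + p.2].
  rewrite /E; case: pselect => [[[n0 dl0] crv rhol [e12 L0] tt]|?] /=; last by exists (0, 0).
  have [wE|nwE] := pselect (small_score (level n) w); last by exists (0, 0).
  have e01 : 0 <= eps n <= 2^-1 by rewrite eps_ge0.
  have [c [rem [h1 h2 h3]]] := log_marginal_approximation bC2 (glm n n0) (m2n n n0) n0
    dl0 (k_gt0 n n0) e01 tt L0 (qmle n n0) crv rhol c20 (prior_ge n n0) (prior_le n n0) wE.
  by exists (c, rem).
pose p n w := projT1 (cid (approx n w)).
exists (fun n w => (p n w).1), (fun n w => (p n w).2), E,
  (fun n => `|ln (L n)| + `|ln (U n)|); split => //.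
- by rewrite -[X in _ --> X](addr0 0); apply: cvgD; exact: cvg_abs_ln.
- by move=> n w Enw; exact: (projT2 (cid (approx n w)) Enw).
Unshelve. all: by end_near. Qed.
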